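(* Let $d\ge 1$ and let $G$ denote either $\mathrm{SO}(d)$ or $\mathrm{O}(d)$. Every continuous $G$-invariant valuation $\varphi:\mathcal{K}^d\to\mathbb{C}$ can be approximated uniformly on compact subsets of $\mathcal{K}^d$ by continuous $G$-invariant polynomial valuations. That is, for every compact $\mathcal{C}\subset\mathcal{K}^d$ and every $\epsilon>0$ there exist an integer $\ell\ge0$ and a continuous $G$-invariant valuation $\psi:\mathcal{K}^d\to\mathbb{C}$ that is polynomial of degree at most $\ell$ such that $\sup_{K\in\mathcal{C}}|\varphi(K)-\psi(K)|<\epsilon$.
   Context: $\mathcal{K}^d$ denotes the family of nonempty compact convex subsets of $\mathbb{R}^d$, equipped with the Hausdorff metric. A function $\varphi:\mathcal{K}^d\to L$ ($L$ a finite-dimensional real or complex vector space) is a valuation if $\varphi(K_1\cup K_2)+\varphi(K_1\cap K_2)=\varphi(K_1)+\varphi(K_2)$ for all $K_1,K_2\in\mathcal{K}^d$ with $K_1\cup K_2\in\mathcal{K}^d$; it is continuous if it is continuous with respect to the Hausdorff metric. A valuation $\varphi$ is polynomial of degree at most $\ell$ if for every $K\in\mathcal{K}^d$ the function $x\mapsto\varphi(K+x)$ on $\mathbb{R}^d$ is a polynomial of degree at most $\ell$. $\varphi$ is $G$-invariant if $\varphi(UK)=\varphi(K)$ for all $U\in G$, $K\in\mathcal{K}^d$. *)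

(* Defs.v *)
From HB Require Import structures.
From mathcomp Require Import all_boot all_order all_algebra.
From mathcomp Require Import all_classical all_reals all_analysis.
From mathcomp Require Import complex.
Set Implicit Arguments. Unset Strict Implicit. Unset Printing Implicit Defensive.
Import Order.TTheory GRing.Theory Num.Theory.
Import numFieldTopology.Exports.
Local Open Scope classical_set_scope.
Local Open Scope ring_scope.

Section ConvexBodies.
Variables (R : realType) (d : nat).
Local Notation vec := 'rV[R]_d.

Definition enorm (x : vec) : R := Num.sqrt (\sum_i x ord0 i ^+ 2).

Definition is_convex_set (K : set vec) : Prop :=
  forall x y, K x -> K y -> forall t : R, 0 <= t <= 1 -> K (t *: x + (1 - t) *: y).

Definition convex_body (K : set vec) : Prop :=
  K !=set0 /\ compact K /\ is_convex_set K.

Definition hausdorff_dist (K L : set vec) : R :=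
  inf [set r : R | 0 <= r /\
        (forall x, K x -> exists2 y, L y & enorm (x - y) <= r) /\
        (forall y, L y -> exists2 x, K x & enorm (x - y) <= r)].

Definition hd_open (U : set (set vec)) : Prop :=
  forall K, convex_body K -> U K ->
    exists2 r : R, 0 < r & forall L, convex_body L -> hausdorff_dist K L < r -> U L.

Definition hd_compact (C : set (set vec)) : Prop :=
  (forall K, C K -> convex_body K) /\
  forall (I : Type) (U : I -> set (set vec)),
    (forall i, hd_open (U i)) ->
    (forall K, C K -> exists i, U i K) ->
    exists2 F : set I, finite_set F & forall K, C K -> exists2 i, F i & U i K.

(* valuations K^d -> C (functions are total on sets; only values on K^d matter) *)
Definition is_valuation (phi : set vec -> R[i]) : Prop :=
  forall K1 K2, convex_body K1 -> convex_body K2 -> convex_body (K1 `|` K2) ->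
    phi (K1 `|` K2) + phi (K1 `&` K2) = phi K1 + phi K2.

Definition val_continuous (phi : set vec -> R[i]) : Prop :=
  forall K, convex_body K -> forall e : R, 0 < e ->
    exists2 delta : R, 0 < delta &
      forall L, convex_body L -> hausdorff_dist K L < delta ->
        `|phi L - phi K| < (e%:C)%C.

Definition translate (K : set vec) (x : vec) : set vec := [set y + x | y in K].

Definition is_poly_le (f : vec -> R[i]) (l : nat) : Prop :=
  exists c : {ffun 'I_d -> 'I_l.+1} -> R[i],
    forall x : vec, f x =
      \sum_(a : {ffun 'I_d -> 'I_l.+1} | (\sum_i (a i : nat) <= l)%N)
         c a * \prod_i ((x ord0 i)%:C)%C ^+ (a i).

Definition polynomial_valuation_le (phi : set vec -> R[i]) (l : nat) : Prop :=
  forall K, convex_body K -> is_poly_le (fun x => phi (translate K x)) l.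

Definition in_G (so : bool) (U : 'M[R]_d) : Prop :=
  U *m U^T = 1%:M /\ (so -> \det U = 1).

(* U K = { U x | x in K }; with row vectors, U x corresponds to x *m U^T *)
Definition mx_image (U : 'M[R]_d) (K : set vec) : set vec := [set x *m U^T | x in K].

Definition G_invariant (so : bool) (phi : set vec -> R[i]) : Prop :=
  forall U, in_G so U -> forall K, convex_body K -> phi (mx_image U K) = phi K.

End ConvexBodies.

(* Main.v *)
(** Let [T] be the valuation obtained from [phi] by intersecting bodies with a
    large ball and correcting with the value at the point nearest to the origin,
    so that [T] is continuous and vanishes on bodies far from the origin. Then
    [y |-> T (K + y)] has compact support, and convolving with a Landau kernel
    [c (1 - |y|^2 / M^2)^k] gives a valuation which is polynomial under
    translations, invariant because the kernel is radial, and close to [T] for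
    large [k]. The integral is a functional invariant under all isometries, an
    ultrafilter limit of Riemann sums over the lattices [Z^d / n]. *)

Require Import Defs.
From HB Require Import structures.
From mathcomp Require Import all_boot all_order all_algebra.
From mathcomp Require Import all_classical all_reals all_analysis.
From mathcomp Require Import complex ring lra zify.
Import Order.TTheory GRing.Theory Num.Theory.
Import numFieldTopology.Exports.
Import numFieldNormedType.Exports.
Local Open Scope classical_set_scope.
Local Open Scope ring_scope.

Set Implicit Arguments.
Unset Strict Implicit.
Unset Printing Implicit Defensive.

(** The kernel must be a polynomial in the translation vector, so it cannot be cut off, and a
    polynomial can act as an approximate identity only on a bounded set. This is why the orbit
    [y |-> T (K + y)] needs compact support. Intersecting with a ball gives a valuation, but it
    jumps at bodies that only touch the ball, whose intersection is the single nearest point [n].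
    Subtracting the value at [{n}] with a weight that is 0 for [|n| <= r] and 1 for [|n| = r + 1]
    removes the jump and changes nothing for bodies inside the smaller ball. The result is still a
    valuation because the nearest points of a union and an intersection are those of the two bodies
    in some order. Translation invariance of the integral moves the translation from the body to the
    kernel, whence polynomiality; rotation invariance gives [G]-invariance. A lattice is not
    invariant under rotations. One double count against a tent function yields both invariances up
    to a vanishing error. The sums are not shown to converge; their boundedness gives a limit along
    an ultrafilter. *)

Section EuclideanNorm.
Variables (R : realType) (d : nat).
Local Notation vec := 'rV[R]_d.
Implicit Types (x y z : vec) (t : R).

(** * Euclidean inner product, norm and topology of row vectors *)

Definition dot x y : R := \sum_i x ord0 i * y ord0 i.

Lemma dotC x y : dot x y = dot y x.
Proof. by apply: eq_bigr => i _; rewrite mulrC. Qed.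

Lemma dotDl x y z : dot (x + y) z = dot x z + dot y z.
Proof. by rewrite -big_split; apply: eq_bigr => i _; rewrite mxE mulrDl. Qed.

Lemma dotZl t x y : dot (t *: x) y = t * dot x y.
Proof. by rewrite mulr_sumr; apply: eq_bigr => i _; rewrite mxE mulrA. Qed.

Lemma dotDr x y z : dot x (y + z) = dot x y + dot x z.
Proof. by rewrite dotC dotDl !(dotC x). Qed.

Lemma dotZr t x y : dot x (t *: y) = t * dot x y.
Proof. by rewrite dotC dotZl (dotC x). Qed.

Lemma dotNl x y : dot (- x) y = - dot x y.
Proof. by rewrite -scaleN1r dotZl mulN1r. Qed.

Lemma dotNr x y : dot x (- y) = - dot x y.
Proof. by rewrite dotC dotNl dotC. Qed.

Lemma dot_ge0 x : 0 <= dot x x.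
Proof. by apply: sumr_ge0 => i _; rewrite -expr2 sqr_ge0. Qed.

Lemma enormE x : enorm x = Num.sqrt (dot x x).
Proof. by congr Num.sqrt; apply: eq_bigr => i _; rewrite expr2. Qed.

Lemma enorm_sqr x : enorm x ^+ 2 = dot x x.
Proof. by rewrite enormE sqr_sqrtr // dot_ge0. Qed.

Lemma enorm_ge0 x : 0 <= enorm x.
Proof. by rewrite enormE sqrtr_ge0. Qed.

Lemma enorm0 : enorm (0 : vec) = 0.
Proof. by rewrite enormE /dot big1 ?sqrtr0// => i _; rewrite mxE mul0r. Qed.

Lemma enormN x : enorm (- x) = enorm x.
Proof. by rewrite !enormE dotNl dotNr opprK. Qed.

Lemma enorm_sub x y : enorm (x - y) = enorm (y - x).
Proof. by rewrite -enormN opprB. Qed.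

Lemma enormZ t x : enorm (t *: x) = `|t| * enorm x.
Proof.
by rewrite !enormE dotZl dotZr mulrA -expr2 sqrtrM ?sqr_ge0// sqrtr_sqr.
Qed.

Lemma enorm_coord x i : `|x ord0 i| <= enorm x.
Proof.
rewrite -(ler_pXn2r (n := 2)) ?nnegrE ?enorm_ge0// enorm_sqr real_normK ?num_real//.
rewrite /dot (bigD1 i)//= -expr2 lerDl sumr_ge0// => j _.
by rewrite -expr2 sqr_ge0.
Qed.

Lemma enorm_eq0 x : enorm x <= 0 -> x = 0.
Proof.
move=> x0; apply/rowP => i; rewrite mxE; apply/normr0_eq0/eqP.
by rewrite eq_le normr_ge0 (le_trans (enorm_coord x i)).
Qed.

Lemma dot_enorm x y : dot x y <= enorm x * enorm y.
Proof.
have [/enorm_eq0 ->|x0] := leP (enorm x) 0.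
  by rewrite enorm0 mul0r /dot big1// => i _; rewrite mxE mul0r.
have [/enorm_eq0 ->|y0] := leP (enorm y) 0.
  by rewrite enorm0 mulr0 /dot big1// => i _; rewrite mxE mulr0.
have := dot_ge0 (enorm y *: x - enorm x *: y).
rewrite !(dotDl, dotDr, dotNl, dotNr, dotZl, dotZr) -!enorm_sqr (dotC y x).
set a := enorm x; set b := enorm y; set c := dot x y => h.
have : 0 <= (a * b) * (a * b - c) by nra.
by rewrite pmulr_rge0 ?mulr_gt0// subr_ge0.
Qed.

Lemma enormD x y : enorm (x + y) <= enorm x + enorm y.
Proof.
rewrite -(ler_pXn2r (n := 2)) ?nnegrE ?addr_ge0 ?enorm_ge0// enorm_sqr.
rewrite !(dotDl, dotDr) -!enorm_sqr (dotC y x).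
by have := dot_enorm x y; nra.
Qed.

Lemma enormB x y : enorm (x - y) <= enorm x + enorm y.
Proof. by rewrite -(enormN y) enormD. Qed.

Lemma enorm_dist_trans y x z : enorm (x - z) <= enorm (x - y) + enorm (y - z).
Proof.
have -> : x - z = (x - y) + (y - z) by rewrite addrA subrK.
exact: enormD.
Qed.

Lemma enorm_lip x y : `|enorm x - enorm y| <= enorm (x - y).
Proof.
rewrite ler_norml.
have := enormD (x - y) y; rewrite subrK => h1.
by have := enormD (y - x) x; rewrite subrK enorm_sub => h2; lra.
Qed.

Lemma parallelogram x y :
  enorm (x - y) ^+ 2 = 2 * enorm x ^+ 2 + 2 * enorm y ^+ 2
                       - 4 * enorm (2^-1 *: (x + y)) ^+ 2.
Proof.
rewrite !enorm_sqr !(dotDl, dotDr, dotNl, dotNr, dotZl, dotZr) (dotC y x).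
by field.
Qed.

Lemma dotE x y : dot x y = (x *m y^T) ord0 ord0.
Proof. by rewrite mxE; apply: eq_bigr => i _; rewrite mxE. Qed.

Lemma enorm_orth (U : 'M[R]_d) x : U *m U^T = 1%:M -> enorm (x *m U) = enorm x.
Proof.
move=> hU; rewrite !enormE !dotE trmx_mul -mulmxA (mulmxA U) hU.
by rewrite mul1mx.
Qed.

Lemma enorm_le_sum x : enorm x <= \sum_i `|x ord0 i|.
Proof.
have s0 : 0 <= \sum_i `|x ord0 i| by exact: sumr_ge0.
rewrite -(ler_pXn2r (n := 2)) ?nnegrE ?enorm_ge0// enorm_sqr.
rewrite [leRHS]expr2 mulr_suml; apply: ler_sum => i _.
rewrite -expr2 -[x _ _ ^+ 2]real_normK ?num_real// expr2 ler_wpM2l//.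
by rewrite (bigD1 i)//= lerDl sumr_ge0.
Qed.

Lemma enorm_le_coord x t : 0 <= t -> (forall i, `|x ord0 i| <= t) ->
  enorm x <= d%:R * t.
Proof.
move=> t0 xt; apply: (le_trans (enorm_le_sum x)).
apply: (@le_trans _ _ (\sum_(i < d) t)); first exact: ler_sum.
by rewrite sumr_const card_ord mulr_natl.
Qed.

Lemma enorm_mx_norm x : enorm x <= d%:R * `|x|.
Proof.
apply: enorm_le_coord => // i.
by rewrite /Num.norm /= mx_normrE (le_bigmax _ (fun ij => `|x ij.1 ij.2|) (ord0, i)).
Qed.

Lemma mx_norm_enorm x : `|x| <= enorm x.
Proof.
rewrite /Num.norm /= mx_normrE; apply: bigmax_le => [|[i j] _].
  exact: enorm_ge0.
by rewrite (ord1 i); exact: enorm_coord.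
Qed.

(** Phrased with [enorm] because the library norm on row vectors is the maximum norm, which
    rotations do not preserve; [econtP] identifies the two notions of continuity. *)
Definition econt (f : vec -> R) := forall x (e : R), 0 < e ->
  exists2 del, 0 < del & forall y, enorm (x - y) < del -> `|f x - f y| < e.

Lemma nbhs_enormP (A : set vec) x :
  nbhs x A <-> exists2 e : R, 0 < e & forall y, enorm (x - y) < e -> A y.
Proof.
split=> [/nbhs_ballP[e /= e0 eA]|[e e0 eA]].
  exists e => // y xy; apply: eA; rewrite mx_norm_ball /ball_ /=.
  exact: le_lt_trans (mx_norm_enorm _) xy.
(* The divisor [d.+1] instead of [d] keeps the radius positive in dimension 0. *)
apply/nbhs_ballP; exists (e / d.+1%:R); rewrite /= ?divr_gt0//.
move=> y; rewrite mx_norm_ball /ball_ /= => xy; apply: eA.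
apply: (le_lt_trans (enorm_mx_norm _)).
have d0 : (0 : R) < d.+1%:R by [].
move: xy; rewrite ltr_pdivlMr// => /(le_lt_trans _); apply.
by rewrite mulrC ler_wpM2l// ler_nat.
Qed.

Lemma closed_enormP (A : set vec) : closed A <->
  forall x, (forall e : R, 0 < e -> exists2 y, A y & enorm (x - y) < e) -> A x.
Proof.
split=> [cA x h|h x cx].
  apply: cA => B /nbhs_enormP[e e0 eB].
  by have [y Ay xy] := h e e0; exists y; split => //; exact: eB.
apply: h => e e0; have /cx[y [Ay By]] : nbhs x [set y | enorm (x - y) < e].
  by apply/nbhs_enormP; exists e.
by exists y.
Qed.

Lemma compact_enormP (A : set vec) : compact A <->
  closed A /\ exists M : R, forall x, A x -> enorm x <= M.
Proof.
split=> [cA|[cA [M hM]]].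
  split; first by apply: compact_closed cA; exact: norm_hausdorff.
  have [M [_ hM]] := compact_bounded cA.
  exists (d%:R * (`|M| + 1)) => x Ax.
  apply: (le_trans (enorm_mx_norm x)); rewrite ler_wpM2l//.
  by apply: hM => //; rewrite (le_lt_trans (ler_norm _))// ltrDl.
apply: bounded_closed_compact => //; exists M; split; first exact: num_real.
move=> t Mt x Ax; apply: (le_trans (mx_norm_enorm x)).
by rewrite (le_trans (hM x Ax))// ltW.
Qed.

(** Finite subcover with radii depending on the centre; boundedness and uniform continuity
    statements below reduce to finitely many centres through it. *)
Lemma eball_cover (A : set vec) (del : vec -> R) : compact A ->
  (forall x, 0 < del x) ->
  exists s : seq vec, forall y, A y -> exists2 x, x \in s & enorm (x - y) < del x.
Proof.
rewrite compact_cover => cA del0.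
have [||D _ DA] := cA vec setT (fun x => [set y | enorm (x - y) < del x]).
- move=> x _; rewrite openE => y /= xy; apply/nbhs_enormP.
  exists (del x - enorm (x - y)); rewrite ?subr_gt0// => z yz /=.
  by have := enorm_dist_trans y x z; lra.
- by move=> y _; exists y => //=; rewrite subrr enorm0.
exists (finmap.enum_fset D) => y /DA[x /= xD xy].
by exists x.
Qed.

Lemma eball_compact (M : R) : compact [set x : vec | enorm x <= M].
Proof.
apply/compact_enormP; split; last by exists M.
apply/closed_enormP => x h; apply/ler_addgt0Pr => e e0.
have [y /= yM xy] := h e e0.
by have := enormD y (x - y); rewrite addrC subrK; lra.
Qed.

End EuclideanNorm.
Arguments enorm_dist_trans {R d}.
Arguments eball_compact {R} d M.

(** * Continuous functions with compact support *)

Section CompactSupport.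
Variables (R : realType) (d : nat).
Local Notation vec := 'rV[R]_d.
Implicit Types (x y z : vec) (f g : vec -> R).

Lemma econtP f : econt f <-> forall x, f y @[y --> x] --> f x.
Proof.
split=> [cf x|cf x e e0].
  move=> B /nbhs_ballP[e e0 eB]; have [del del0 h] := cf x e e0.
  by apply/nbhs_enormP; exists del => // y xy; apply: eB; exact: h.
have := cf x _ (nbhsx_ballx (f x) e e0).
by move=> /nbhs_enormP[del del0 h]; exists del.
Qed.

Lemma econt_cst c : econt (fun _ : vec => c).
Proof. by move=> x e e0; exists 1 => // y _; rewrite subrr normr0. Qed.

Lemma econtD f g : econt f -> econt g -> econt (fun x => f x + g x).
Proof.
by move=> /econtP cf /econtP cg; apply/econtP => x; exact: cvgD (cf x) (cg x).
Qed.

Lemma econtM f g : econt f -> econt g -> econt (fun x => f x * g x).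
Proof.
by move=> /econtP cf /econtP cg; apply/econtP => x; exact: cvgM (cf x) (cg x).
Qed.

Lemma econtX f k : econt f -> econt (fun x => f x ^+ k).
Proof.
move=> cf; elim: k => [|k IH]; first by under eq_fun do rewrite expr0; exact: econt_cst.
by under eq_fun do rewrite exprS; exact: econtM.
Qed.

Lemma econt_lip f (C : R) : (forall x y, `|f x - f y| <= C * enorm (x - y)) ->
  econt f.
Proof.
move=> h x e e0; exists (e / (`|C| + 1)); first by rewrite divr_gt0// ltr_wpDl.
move=> y; rewrite ltr_pdivlMr ?ltr_wpDl// => hy.
apply: le_lt_trans (h x y) (le_lt_trans _ hy); rewrite mulrC ler_wpM2l ?enorm_ge0//.
by rewrite (le_trans (ler_norm C))// lerDl.
Qed.

Lemma econt_coord i : econt (fun x : vec => x ord0 i).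
Proof.
apply: (@econt_lip _ 1) => x y; rewrite mul1r.
by have := enorm_coord (x - y) i; rewrite !mxE.
Qed.

Lemma econt_enorm : econt (@enorm R d).
Proof. by apply: (@econt_lip _ 1) => x y; rewrite mul1r enorm_lip. Qed.

Lemma econt_isom f (U : 'M[R]_d) t : U *m U^T = 1%:M -> econt f ->
  econt (fun x => f (x *m U + t)).
Proof.
move=> hU cf x e e0; have [del del0 h] := cf (x *m U + t) e e0.
exists del => // y xy; apply: h.
by rewrite opprD addrACA subrr addr0 -mulmxBl enorm_orth.
Qed.

Definition cc f := econt f /\ exists A : R, forall x, A < enorm x -> f x = 0.

Lemma ccD f g : cc f -> cc g -> cc (fun x => f x + g x).
Proof.
move=> [cf [A fA]] [cg [B gB]]; split; first exact: econtD.
exists (Num.max A B) => x; rewrite gt_max => /andP[/fA -> /gB ->].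
by rewrite addr0.
Qed.

Lemma ccM f g : cc f -> econt g -> cc (fun x => f x * g x).
Proof.
move=> [cf [A fA]] cg; split; first exact: econtM.
by exists A => x /fA ->; rewrite mul0r.
Qed.

Lemma ccZ c f : cc f -> cc (fun x => c * f x).
Proof.
move=> [cf [A fA]]; split; first by apply: econtM => //; exact: econt_cst.
by exists A => x /fA ->; rewrite mulr0.
Qed.

Lemma cc0 : cc (fun _ : vec => 0).
Proof. by split; [exact: econt_cst | exists 0]. Qed.

Lemma cc_sum (I : Type) (s : seq I) (P : pred I) (F : I -> vec -> R) :
  (forall i, cc (F i)) -> cc (fun x => \sum_(i <- s | P i) F i x).
Proof.
move=> h; elim: s => [|i s IH].
  by under eq_fun do rewrite big_nil; exact: cc0.
under eq_fun do rewrite big_cons.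
by case: (P i) => //; apply: ccD.
Qed.

Lemma cc_isom f (U : 'M[R]_d) t : U *m U^T = 1%:M -> cc f ->
  cc (fun x => f (x *m U + t)).
Proof.
move=> hU [cf [A fA]]; split; first exact: econt_isom.
exists (A + enorm t) => x Ax; apply: fA.
by have := enormB (x *m U + t) t; rewrite addrK enorm_orth//; lra.
Qed.

Lemma seq_lower (T : eqType) (s : seq T) (F : T -> R) : (forall a, 0 < F a) ->
  exists2 m : R, 0 < m & forall a, a \in s -> m <= F a.
Proof.
move=> F0; elim: s => [|a s [m m0 h]]; first by exists 1.
exists (Num.min m (F a)); first by rewrite lt_min m0 F0.
by move=> x; rewrite inE ge_min => /predU1P[->|/h ->//]; rewrite lexx orbT.
Qed.

Lemma seq_upper (T : eqType) (s : seq T) (F : T -> R) :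
  exists2 m : R, 0 <= m & forall a, a \in s -> F a <= m.
Proof.
elim: s => [|a s [m m0 h]]; first by exists 0.
exists (Num.max m (F a)); first by rewrite le_max m0.
by move=> x; rewrite inE le_max => /predU1P[->|/h ->//]; rewrite lexx orbT.
Qed.

Lemma cc_supp f : cc f -> exists2 A : R, 0 <= A & forall x, A < enorm x -> f x = 0.
Proof.
move=> [_ [A fA]]; exists (Num.max 0 A); first by rewrite le_max lexx.
by move=> x; rewrite gt_max => /andP[_ /fA].
Qed.

Lemma cc_bounded f : cc f -> exists2 S : R, 0 <= S & forall x, `|f x| <= S.
Proof.
move=> cf; have [A A0 fA] := cc_supp cf; case: cf => cf _.
pose del x := sval (cid2 (cf x 1 ltr01)).
have del0 x : 0 < del x by rewrite /del; case: cid2.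
have delP x y : enorm (x - y) < del x -> `|f x - f y| < 1.
  by rewrite /del; case: cid2 => //= r _ h; exact: h.
have [s sP] := eball_cover (eball_compact _ A) del0.
have [m m0 hm] := seq_upper s (fun x => `|f x|).
exists (m + 1); first by rewrite addr_ge0.
move=> x; have [Ax|/fA ->] := leP (enorm x) A; last by rewrite normr0 addr_ge0.
have [y ys /delP] := sP x Ax; rewrite distrC => h.
have := ler_normD (f x - f y) (f y); rewrite subrK.
by have := hm y ys; lra.
Qed.

Lemma cc_unif f (e : R) : cc f -> 0 < e ->
  exists2 del, 0 < del & forall x y, enorm (x - y) < del -> `|f x - f y| < e.
Proof.
move=> cf e0; have [A A0 fA] := cc_supp cf; case: cf => cf _.
have e20 : 0 < e / 2 by lra.
pose del x := sval (cid2 (cf x _ e20)).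
have del0 x : 0 < del x by rewrite /del; case: cid2.
have delP x y : enorm (x - y) < del x -> `|f x - f y| < e / 2.
  by rewrite /del; case: cid2 => //= r _ h; exact: h.
have hdel0 x : 0 < del x / 2 by have := del0 x; lra.
(* Half radii give a Lebesgue number. The margin 1 around the ball of radius [A] ensures that, if
   [x] is outside the larger ball and [y] within 1 of it, then [f] vanishes at both. *)
have [s sP] := eball_cover (eball_compact _ (A + 1)) hdel0.
have [m m0 hm] := seq_lower s hdel0.
exists (Num.min 1 m); first by rewrite lt_min ltr01.
move=> x y; rewrite lt_min => /andP[xy1 xym].
have [Ax|Ax] := leP (enorm x) (A + 1).
  have [z zs zx] := sP x Ax.
  have zx' : enorm (z - x) < del z by have := hdel0 z; lra.
  have /delP h1 : enorm (z - y) < del z.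
    by have := enorm_dist_trans x z y; have := hm z zs; lra.
  have h2 := delP _ _ zx'.
  have -> : f x - f y = (f z - f y) - (f z - f x) by ring.
  by have := ler_normB (f z - f y) (f z - f x); lra.
rewrite (fA x) ?(fA y) ?subrr ?normr0//; last lra.
by have := enormD (x - y) y; rewrite subrK; lra.
Qed.

(** A tent of height and radius [e]: radial and 1-Lipschitz, so the effect of moving its centre is
    explicit. It serves as an unnormalised approximate identity. *)
Definition bump (e : R) x : R := Num.max 0 (e - enorm x).

Lemma bump_ge0 e x : 0 <= bump e x.
Proof. by rewrite /bump le_max lexx. Qed.

Lemma bump_eq0 e x : e <= enorm x -> bump e x = 0.
Proof. by move=> h; apply/max_idPl; rewrite subr_le0. Qed.

Lemma bump_lip e x y : `|bump e x - bump e y| <= enorm (x - y).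
Proof.
have := enorm_lip x y; rewrite /bump !ler_norml => /andP[h1 h2].
by case: (leP 0 (e - enorm x)); case: (leP 0 (e - enorm y)); lra.
Qed.

Lemma bump_ge e x : e - enorm x <= bump e x.
Proof. by rewrite /bump le_max lexx orbT. Qed.

Lemma cc_bump e : cc (bump e).
Proof.
split; last by exists e => x /ltW; exact: bump_eq0.
by apply: (@econt_lip _ 1) => x y; rewrite mul1r bump_lip.
Qed.

(** Flattening the tent at height 1 gives a Lipschitz cutoff that is 1 on the ball of radius
    [e - 1]. *)
Lemma cc_cutoff e : cc (fun x => Num.min 1 (bump e x)).
Proof.
split; last by exists e => x /ltW xe; rewrite bump_eq0// (min_idPr _) ?ler01.
apply: (@econt_lip _ 1) => x y; rewrite mul1r; have := bump_lip e x y.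
rewrite !ler_norml => /andP[h1 h2].
by case: (leP 1 (bump e x)); case: (leP 1 (bump e y)); lra.
Qed.

Lemma cutoff1 (e : R) x : enorm x + 1 <= e -> Num.min 1 (bump e x) = 1.
Proof. by move=> h; apply/min_idPl; have := bump_ge e x; lra. Qed.

End CompactSupport.

(** * Riemann sums over finite lattice boxes, with bounds uniform in the mesh *)

Section LatticeSums.
Variables (R : realType) (d : nat).
Local Notation vec := 'rV[R]_d.
Implicit Types (x y : vec) (f g : vec -> R) (n : nat).

(** Mesh [1 / (n + 1)] and half-side [n + 1]: the mesh shrinks while the box exhausts the space.
    Indices are offset by [(n + 1)^2], and the ordinal type with its addition modulo the size makes
    shifts permutations of the box. *)
Definition lattice n := {ffun 'I_d -> 'I_(n.+1 ^ 2).*2.+1}.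

Definition lattice_pt n (z : lattice n) : vec :=
  \row_i (((z i)%:R - (n.+1 ^ 2)%:R) / n.+1%:R).

Definition rsum n f : R :=
  (n.+1%:R ^+ d)^-1 * \sum_(z : lattice n) f (lattice_pt z).

Lemma mesh_gt0 n : 0 < n.+1%:R :> R. Proof. by []. Qed.

Lemma rsumD n f g : rsum n (fun x => f x + g x) = rsum n f + rsum n g.
Proof. by rewrite /rsum big_split mulrDr. Qed.

Lemma rsumZ n c f : rsum n (fun x => c * f x) = c * rsum n f.
Proof. by rewrite /rsum -mulr_sumr mulrCA. Qed.

Lemma rsumB n f g : rsum n (fun x => f x - g x) = rsum n f - rsum n g.
Proof. by rewrite /rsum sumrB mulrBr. Qed.

Lemma rsum_le n f g : (forall x, f x <= g x) -> rsum n f <= rsum n g.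
Proof.
move=> h; rewrite /rsum ler_wpM2l ?invr_ge0 ?exprn_ge0//.
by apply: ler_sum => z _; exact: h.
Qed.

Lemma rsum_dist n f g h : (forall x, `|f x - g x| <= h x) ->
  `|rsum n f - rsum n g| <= rsum n h.
Proof.
move=> fgh; rewrite -rsumB /rsum normrM ger0_norm ?invr_ge0 ?exprn_ge0//.
rewrite ler_wpM2l ?invr_ge0 ?exprn_ge0// (le_trans (ler_norm_sum _ _ _))//.
by apply: ler_sum => z _; exact: fgh.
Qed.

Lemma rsum_exchange n (F : vec -> vec -> R) :
  rsum n (fun x => rsum n (fun y => F x y)) = rsum n (fun y => rsum n (fun x => F x y)).
Proof.
rewrite /rsum; congr (_ * _); rewrite -!mulr_sumr; congr (_ * _).
exact: exchange_big.
Qed.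

Definition ind (A : R) x : R := if enorm x <= A then 1 else 0.

Lemma rsum_ind n A : rsum n (ind A) =
  (n.+1%:R ^+ d)^-1 * #|[pred z : lattice n | enorm (lattice_pt z) <= A]|%:R.
Proof.
congr (_ * _); rewrite -sum1_card natr_sum [RHS]big_mkcond /=.
by apply: eq_bigr => z _; rewrite /ind unfold_in /=.
Qed.

(** Indices at distance at most [k] from the centre [N], written with sums to avoid truncated
    subtraction. *)
Definition near_mid N k := [pred j : 'I_N.*2.+1 | (N <= j + k)%N && (j <= N + k)%N].

Lemma expn_le a b e : (a <= b)%N -> (a ^ e <= b ^ e)%N.
Proof. by case: e => // e; rewrite leq_exp2r. Qed.

Lemma near_mid_le N k : (#|near_mid N k| <= k.*2.+1)%N.
Proof.
rewrite -[leqRHS]card_ord.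
apply: (@leq_card_in _ _ (fun j : 'I_N.*2.+1 => inord (j + k - N) : 'I_k.*2.+1)).
move=> i j; rewrite !inE => /andP[i1 i2] /andP[j1 j2] /(congr1 val).
by rewrite /= !inordK; [move=> h; apply: val_inj => /=; lia | lia | lia].
Qed.

(** Only the indices from the centre upwards are counted; the factor lost is harmless, as the lower
    bound serves only for positivity. *)
Lemma near_mid_ge N k : (k <= N)%N -> (k.+1 <= #|near_mid N k|)%N.
Proof.
move=> kN.
have inj : injective (fun i : 'I_k.+1 => inord (N + i) : 'I_N.*2.+1).
  move=> i j /(congr1 val); have hi := ltn_ord i; have hj := ltn_ord j.
  by rewrite /= !inordK; [move=> h; apply: val_inj => /=; lia | lia | lia].
rewrite -[leqLHS]card_ord -(@card_codom _ _ _ inj); apply/subset_leq_card/fintype.subsetP.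
move=> j /codomP[i ->]; have hi := ltn_ord i; rewrite !inE.
by rewrite inordK; [lia | lia].
Qed.

Lemma lattice_coord n (z : lattice n) i (k : R) :
  (`|lattice_pt z ord0 i| <= k) = (`|(z i)%:R - (n.+1 ^ 2)%:R| <= k * n.+1%:R).
Proof.
rewrite mxE normrM normfV (ger0_norm (ltW (mesh_gt0 n))).
by rewrite ler_pdivrMr// mesh_gt0.
Qed.

(** The ball lies in a cube of half-side [A], so each index takes at most [2k + 1] values with [k]
    the integer part of [A (n + 1)], and [2k + 1 <= (2A + 1)(n + 1)]. *)
Lemma rsum_ind_le n (A : R) : 0 <= A -> rsum n (ind A) <= (2 * A + 1) ^+ d.
Proof.
move=> A0; rewrite rsum_ind ler_pdivrMl ?exprn_gt0// -exprMn_comm; last exact: mulrC.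
set k := Num.truncn (A * n.+1%:R).
have An0 : 0 <= A * n.+1%:R by rewrite mulr_ge0.
have /andP[k1 k2] := truncn_itv An0.
apply: (@le_trans _ _ (k.*2.+1%:R ^+ d)).
  rewrite -natrX ler_nat.
  apply: (@leq_trans #|ffun_on (near_mid (n.+1 ^ 2) k) : pred (lattice n)|); last first.
    by rewrite card_ffun_on card_ord expn_le// near_mid_le.
  apply/subset_leq_card/fintype.subsetP => z; rewrite inE => zA.
  apply/ffun_onP => i; rewrite inE.
  have := le_trans (enorm_coord (lattice_pt z) i) zA.
  rewrite lattice_coord ler_norml => /andP[h1 h2].
  have : `|(z i)%:R - (n.+1 ^ 2)%:R| < k.+1%:R :> R.
    by rewrite ltr_norml; lra.
  rewrite ltr_norml => /andP[h3 h4]; apply/andP; split.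
    by rewrite -ltnS -addnS -(ltr_nat R) natrD; lra.
  by rewrite -ltnS -addnS -(ltr_nat R) natrD; lra.
rewrite lerXn2r ?nnegrE ?ler0n//; first by rewrite mulr_ge0// addr_ge0// mulr_ge0.
rewrite -addn1 -muln2 natrD natrM.
have n1 : 1 <= n.+1%:R :> R by rewrite ler1n.
by move: k1; rewrite -/k; lra.
Qed.

(** The cube of half-side [r / (d + 1)] lies in the ball, by comparison of the Euclidean and maximum
    norms; [r <= n + 1] makes it fit into the lattice box. *)
Lemma rsum_ind_ge n (r : R) : 0 <= r -> r <= n.+1%:R ->
  (r / d.+1%:R) ^+ d <= rsum n (ind r).
Proof.
move=> r0 rn; rewrite rsum_ind ler_pdivlMl ?exprn_gt0// -exprMn_comm; last exact: mulrC.
set q := r / d.+1%:R.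
have q0 : 0 <= q by rewrite divr_ge0.
have qd : d%:R * q <= r.
  rewrite /q mulrCA -[leRHS]mulr1 ler_wpM2l// ler_pdivrMr// mul1r ler_nat//.
have qn : q <= n.+1%:R.
  by apply: le_trans rn; rewrite ler_pdivrMr// ler_peMr// ler1n.
set k := Num.truncn (n.+1%:R * q).
have nq0 : 0 <= n.+1%:R * q by rewrite mulr_ge0.
have /andP[k1 k2] := truncn_itv nq0.
have kN : (k <= n.+1 ^ 2)%N.
  rewrite -(ler_nat R) (le_trans k1)// expnS expn1 natrM ler_wpM2l//.
apply: (@le_trans _ _ (k.+1%:R ^+ d)).
  by rewrite lerXn2r ?nnegrE ?ler0n// ltW.
rewrite -natrX ler_nat.
apply: (@leq_trans #|ffun_on (near_mid (n.+1 ^ 2) k) : pred (lattice n)|).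
  by rewrite card_ffun_on card_ord expn_le// near_mid_ge.
apply/subset_leq_card/fintype.subsetP => z /ffun_onP zk; rewrite inE.
apply: le_trans qd; apply: enorm_le_coord => // i; rewrite lattice_coord.
have := zk i; rewrite inE => /andP[h1 h2].
have {}h1 : (n.+1 ^ 2)%:R <= (z i)%:R + k%:R :> R by rewrite -natrD ler_nat.
have {}h2 : (z i)%:R <= (n.+1 ^ 2)%:R + k%:R :> R by rewrite -natrD ler_nat.
by rewrite ler_norml; move: k1; rewrite -/k mulrC; lra.
Qed.

(** The bound is free of [n]: all Riemann sums of [f] stay in one segment, where a limit can be
    extracted. *)
Lemma rsum_bound n f (A S : R) : 0 <= A -> (forall x, A < enorm x -> f x = 0) ->
  (forall x, `|f x| <= S) -> `|rsum n f| <= S * (2 * A + 1) ^+ d.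
Proof.
move=> A0 fA fS.
have S0 : 0 <= S by exact: le_trans (fS 0).
apply: (@le_trans _ _ (S * rsum n (ind A))); last by rewrite ler_wpM2l// rsum_ind_le.
rewrite -rsumZ; have := @rsum_dist n f (fun=> 0) (fun x => S * ind A x).
rewrite {2}/rsum big1// mulr0 subr0; apply => x; rewrite subr0 /ind.
by case: (leP (enorm x) A) => [_|/fA ->]; rewrite ?mulr1// normr0 mulr0.
Qed.

Lemma rsum_bump_ge n (e : R) : 0 < e -> e <= n.+1%:R ->
  e / 2 * (e / 2 / d.+1%:R) ^+ d <= rsum n (bump e).
Proof.
move=> e0 en; have e20 : 0 <= e / 2 by lra.
apply: (@le_trans _ _ (e / 2 * rsum n (ind (e / 2)))).
  by rewrite ler_wpM2l// rsum_ind_ge//; lra.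
rewrite -rsumZ; apply: rsum_le => x; rewrite /ind; case: (leP (enorm x) (e / 2)) => h.
  by have := bump_ge e x; rewrite mulr1; lra.
by rewrite mulr0 bump_ge0.
Qed.

End LatticeSums.

Lemma eq_mod_cases a b m : (a < m.*2)%N -> (b < m.*2)%N -> (a = b %[mod m])%N ->
  a = b \/ (a = b + m \/ b = a + m)%N.
Proof.
wlog ba : a b / (b <= a)%N.
  move=> h am bm ab; have [/h|/ltnW/h] := leqP b a; first by apply.
  by move=> /(_ bm am (esym ab)); intuition.
move=> am bm /eqP; rewrite eqn_mod_dvd// => /dvdnP[[|[|k]] h]; [by left; lia| by right; left; lia|].
by exfalso; move: h; rewrite !mulSn; lia.
Qed.

(** Here [N] encodes the origin and [a] the cyclic sum of the points encoded by [b] and [c]. If the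
    sum wraps around, then [a] is more than [N] away from [c], and [b] lies far from the centre
    unless [c] does. *)
Lemma cyclic_wrap N a b c : (a < N.*2.+1)%N -> (b < N.*2.+1)%N -> (c < N.*2.+1)%N ->
  (a + N = b + c %[mod N.*2.+1])%N -> (a + N != b + c)%N ->
  [/\ N + 1 + c <= a, b + c + N + 1 <= a & a <= N + N]%N \/
  (N + 1 + a <= c /\ a + N + N + N + 1 <= b + c)%N.
Proof.
move=> h1 h2 h3 h ne.
have [||//||] := @eq_mod_cases (a + N) (b + c) N.*2.+1; [by lia|by lia| |].
  by move/eqP; rewrite (negbTE ne).
by case=> w; [left|right]; split; lia.
Qed.

Section AsymptoticInvariance.
Variables (R : realType) (d : nat).
Local Notation vec := 'rV[R]_d.
Implicit Types (x y : vec) (f g : vec -> R) (n : nat).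

(* The lattice box is a cyclic group, so shifting by a lattice point permutes
   it; the wrapped-around points are too far away to be seen by the bump. *)
Lemma rsum_bump_shift n (u : lattice d n) (e A : R) :
  enorm (lattice_pt R u) <= A -> 0 <= e -> e + A <= n.+1%:R ->
  rsum n (fun x : vec => bump e (x - lattice_pt R u)) = rsum n (@bump R d e).
Proof.
move=> uA e0 eA; rewrite /rsum; congr (_ * _).
set N := (n.+1 ^ 2)%N; have pN : N%:R = n.+1%:R * n.+1%:R :> R by rewrite /N expnS expn1 natrM.
have A0 : 0 <= A by exact: le_trans (enorm_ge0 _) uA.
pose N0 : 'I_N.*2.+1 := inord N.
pose sh (z : lattice d n) : lattice d n := [ffun i => z i + (u i - N0)].
have shI : injective sh.
  by move=> z z' /ffunP h; apply/ffunP => i; have := h i; rewrite !ffunE => /addIr.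
rewrite (reindex_inj shI); apply: eq_bigr => z _.
have shE i : ((sh z i + N) %% N.*2.+1 = (z i + u i) %% N.*2.+1)%N.
  have : sh z i + N0 = z i + u i by rewrite ffunE -addrA subrK.
  by move=> /(congr1 val) /=; rewrite inordK//; lia.
have p0 : 0 < n.+1%:R :> R by [].
have [/forallP allE|/forallPn[i ne]] :=
  boolP [forall i, (sh z i + N == z i + u i)%N].
  congr bump; apply/rowP => i; rewrite !mxE.
  have /eqP/(congr1 (fun k => k%:R : R)) := allE i; rewrite !natrD => h.
  by rewrite -/N -mulrBl; congr (_ / _); lra.
have wrap : [/\ N + 1 + u i <= sh z i, z i + u i + N + 1 <= sh z i & sh z i <= N + N]%N \/
    (N + 1 + sh z i <= u i /\ sh z i + N + N + N + 1 <= z i + u i)%N.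
  by apply: cyclic_wrap; rewrite // -/N ltn_ord.
have hu : `|lattice_pt R u ord0 i| <= A by exact: le_trans (enorm_coord _ _) uA.
rewrite lattice_coord -/N ler_norml in hu.
have far1 : N%:R + 1 <= `|(sh z i)%:R - (u i)%:R| :> R.
  rewrite ler_normr; have [[w _ _]|[w _]] := wrap; apply/orP; [left|right];
    by move: w; rewrite -(ler_nat R) !natrD; lra.
have far2 : N%:R + 1 - A * n.+1%:R <= `|(z i)%:R - N%:R| :> R.
  rewrite ler_normr; have [[_ w w']|[_ w]] := wrap; apply/orP; [right|left].
    by move: w w'; rewrite -!(ler_nat R) !natrD; lra.
  by move: w; rewrite -!(ler_nat R) !natrD; have := ler0n R (sh z i); lra.
rewrite !bump_eq0//.
  apply: le_trans (enorm_coord _ i); rewrite mxE -/N normrM normfV (ger0_norm (ltW p0)).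
  by rewrite ler_pdivlMr//; apply: le_trans far2; nra.
apply: le_trans (enorm_coord _ i); rewrite !mxE -/N -mulrBl.
rewrite opprB addrA subrK normrM normfV (ger0_norm (ltW p0)).
by rewrite ler_pdivlMr//; apply: le_trans far1; nra.
Qed.

Lemma lattice_approx n x : enorm x <= n.+1%:R ->
  exists u : lattice d n, enorm (x - lattice_pt R u) <= d%:R / n.+1%:R.
Proof.
move=> xn; set p : R := n.+1%:R; have p0 : 0 < p by [].
pose t i := (x ord0 i + p) * p.
have xi i : - p <= x ord0 i <= p.
  by rewrite -ler_norml (le_trans (enorm_coord x i)).
have t0 i : 0 <= t i.
  by rewrite /t mulr_ge0// ?(ltW p0)//; have /andP[] := xi i; lra.
have tN i : (Num.truncn (t i) <= (n.+1 ^ 2).*2)%N.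
  rewrite truncn_le_nat (@le_lt_trans _ _ ((n.+1 ^ 2).*2)%:R)// ?ltr_nat//.
  rewrite -muln2 natrM expnS expn1 natrM -/p /t.
  by have /andP[] := xi i; nra.
exists [ffun i => inord (Num.truncn (t i))].
apply: enorm_le_coord => [|i]; first by rewrite invr_ge0.
rewrite !mxE ffunE inordK ?ltnS// -/p expnS expn1 natrM -/p.
have /andP[k1 k2] := truncn_itv (t0 i).
have -> : x ord0 i - ((Num.truncn (t i))%:R - p * p) / p = (t i - (Num.truncn (t i))%:R) / p.
  by rewrite /t; field; rewrite gt_eqF.
rewrite normrM normfV (ger0_norm (ltW p0)) ler_pdivrMr// mulVf ?gt_eqF//.
by rewrite ger0_norm ?subr_ge0//; move: k2; rewrite -natr1; lra.
Qed.

(** Shifts by lattice points are exact. An arbitrary [x] is within [d / (n + 1)] of a lattice point,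
    and as the tent is 1-Lipschitz each term changes by at most that, on a ball of fixed radius. *)
Lemma rsum_equidistributed (A e eta : R) : 0 <= A -> 0 < e -> 0 < eta ->
  exists n0, forall n, (n0 <= n)%N -> forall x : vec, enorm x <= A ->
    `|rsum n (fun y : vec => bump e (y - x)) - rsum n (@bump R d e)| <= eta.
Proof.
move=> A0 e0 eta0; pose B := A + d%:R + e.
have d0 : 0 <= d%:R :> R by [].
pose C : R := (2 * B + 1) ^+ d.
have C0 : 0 <= C by rewrite exprn_ge0//; rewrite /B; lra.
(* Beyond this index the box contains the ball of radius [B] and the total error [d C / (n + 1)] is
   at most [eta]. *)
exists (Num.truncn (B + d%:R * C / eta)) => n n0n x xA.
set p : R := n.+1%:R; have p0 : 0 < p by [].
have p1 : 1 <= p by rewrite ler1n.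
have K0 : 0 <= d%:R * C / eta by rewrite divr_ge0 ?mulr_ge0// ltW.
have pB : B + d%:R * C / eta <= p.
  have B0 : 0 <= B + d%:R * C / eta by rewrite /B; lra.
  have /andP[_ /ltW h] := truncn_itv B0; apply: le_trans h _.
  by rewrite ler_nat.
have [|u xu] := @lattice_approx n x; first by apply: le_trans pB; rewrite /B; lra.
have dp : d%:R / p <= d%:R by rewrite ler_pdivrMr// ler_peMr.
have uA : enorm (lattice_pt R u) <= A + d%:R.
  have := enormB x (x - lattice_pt R u); rewrite opprB addrC subrK.
  have := le_trans xu dp.
  by move: xA; lra.
rewrite -(rsum_bump_shift uA (ltW e0)); last by rewrite -/p; move: pB; rewrite /B; lra.
apply: (@le_trans _ _ (d%:R / p * rsum n (ind B))); last first.
  apply: (@le_trans _ _ (d%:R / p * C)).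
    by rewrite ler_wpM2l ?divr_ge0 ?(ltW p0)//; apply: rsum_ind_le; rewrite /B; lra.
  rewrite mulrAC ler_pdivrMr// mulrC -ler_pdivrMl// mulrC.
  by move: pB; rewrite /B; lra.
rewrite -rsumZ; apply: rsum_dist => y; rewrite /ind.
case: (leP (enorm y) B) => yB.
  rewrite mulr1; apply: le_trans (bump_lip _ _ _) _.
  by rewrite opprB addrC addrA subrK enorm_sub.
have h1 := enormD (y - x) x; have h2 := enormD (y - lattice_pt R u) (lattice_pt R u).
rewrite !subrK in h1 h2.
by rewrite !bump_eq0 ?subrr ?normr0 ?mulr0//; move: yB; rewrite /B; lra.
Qed.

(* Double counting: sum [f w * bump e (w - g z)] over pairs of lattice points;
   summing over [z] first gives [rsum f * rsum (bump e)], summing over [w]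
   first gives [rsum (f \o g) * rsum (bump e)], up to small errors. *)
Lemma rsum_isom f (U : 'M[R]_d) t (eps : R) : U *m U^T = 1%:M -> cc f -> 0 < eps ->
  exists n0, forall n, (n0 <= n)%N ->
    `|rsum n (fun x => f (x *m U + t)) - rsum n f| <= eps.
Proof.
move=> hU cf eps0; have [A A0 fA] := cc_supp cf; have [S S0 fS] := cc_bounded cf.
have t0 := enorm_ge0 t.
(* The ball of radius [B] contains the support of [f] and every point whose image has norm at most
   [A + 1]. *)
pose B := A + 1 + enorm t; pose C : R := (2 * B + 1) ^+ d.
have B0 : 0 <= B by rewrite /B; lra.
have indC n : rsum n (@ind R d B) <= C by exact: rsum_ind_le.
have C0 : 0 <= C by rewrite exprn_ge0//; lra.
(* Allowed oscillation of [f] on one tent. The two estimates of [D] together leave [2 om C N] and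
   [2 eta S C], and each should be at most half of [eps N]. *)
pose om := eps / (4 * (C + 1)).
have om0 : 0 < om by rewrite divr_gt0// mulr_gt0//; lra.
have omC : 2 * om * C <= eps / 2.
  have : om * (4 * (C + 1)) = eps by rewrite /om mulfVK// gt_eqF// mulr_gt0//; lra.
  by move: om0; nra.
have [del del0 fdel] := cc_unif cf om0.
pose e := Num.min del 1.
have e0 : 0 < e by rewrite lt_min del0 ltr01.
have e1 : e <= 1 by rewrite ge_min lexx orbT.
have ed : e <= del by rewrite ge_min lexx.
pose c : R := e / 2 * (e / 2 / d.+1%:R) ^+ d.
have c0 : 0 < c by rewrite mulr_gt0 ?exprn_gt0 ?divr_gt0//; lra.
(* The entry [c], a lower bound for the tent sum [N], ensures that shifted tent sums are at most
   [2 N]; the other entry makes [2 eta S C] at most [c eps / 2]. *)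
pose eta := Num.min c (c * eps / (4 * (S * C + 1))).
have SC0 : 0 <= S * C by rewrite mulr_ge0.
have eta0 : 0 < eta.
  have SC1 : 0 < S * C + 1 by lra.
  by rewrite lt_min c0/= divr_gt0// mulr_gt0.
have etac : eta <= c by rewrite ge_min lexx.
have etaSC : 2 * eta * (S * C) <= c * eps / 2.
  have : eta <= c * eps / (4 * (S * C + 1)) by rewrite ge_min lexx orbT.
  rewrite ler_pdivlMr; last by rewrite mulr_gt0//; lra.
  by move: eta0; nra.
have [n1 hn1] := rsum_equidistributed (A := B + enorm t + 1) ltac:(lra) e0 eta0.
exists (maxn n1 (Num.truncn e)) => n; rewrite geq_max => /andP[/hn1 {}hn1 ne].
set N := rsum n (@bump R d e).
have cN : c <= N.
  apply: rsum_bump_ge => //; have /andP[_ /ltW h] := truncn_itv (ltW e0).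
  by apply: le_trans h _; rewrite ler_nat.
have N0 : 0 < N by exact: lt_le_trans cN.
pose gi y := (y - t) *m U^T.
have gE x y : enorm (y - (x *m U + t)) = enorm (x - gi y).
  rewrite -(enorm_orth (x - gi y) hU) mulmxBl /gi -mulmxA (mulmx1C hU) mulmx1.
  by rewrite enorm_sub opprB addrA.
have bE x y : bump e (y - (x *m U + t)) = bump e (x - gi y) by rewrite /bump gE.
have norm_g x : enorm x <= enorm (x *m U + t) + enorm t.
  by have := enormB (x *m U + t) t; rewrite addrK enorm_orth.
have norm_gi y : enorm (gi y) <= enorm y + enorm t.
  by rewrite /gi enorm_orth ?trmxK ?(mulmx1C hU)// enormB.
pose D := rsum n (fun w => rsum n (fun z => f w * bump e (w - (z *m U + t)))).
(* For fixed [w] the function of [z] is a tent centred at [gi w], since [gi] inverts the isometry;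
   its sum is therefore close to [N]. *)
have D1 : `|D - rsum n f * N| <= S * eta * C.
  rewrite (mulrC _ N) -rsumZ.
  apply: (@le_trans _ _ (S * eta * rsum n (ind B))); last first.
    by rewrite ler_wpM2l// mulr_ge0// ltW.
  rewrite -rsumZ; apply: rsum_dist => w.
  rewrite rsumZ mulrC -mulrBl normrM /ind mulrC.
  have [wA|wA] := leP (enorm w) A; last first.
    by rewrite fA// normr0 mul0r; case: ifP; rewrite ?mulr1 ?mulr0// mulr_ge0// ltW.
  rewrite ifT ?mulr1; last by rewrite /B; lra.
  rewrite ler_pM//.
  have -> : (fun z => bump e (w - (z *m U + t))) = (fun z => bump e (z - gi w)).
    by apply/funext => z; rewrite bE.
  by apply: hn1; have := norm_gi w; rewrite /B; lra.
(* After the exchange [z], hence [q], is fixed; on the tent around [q] the value [f w] is within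
   [om] of [f q], because [e <= del]. *)
have D2 : `|D - rsum n (fun z => f (z *m U + t)) * N| <= (2 * om * N + S * eta) * C.
  rewrite /D rsum_exchange (mulrC _ N) -rsumZ.
  have omN : 0 <= om * N by rewrite mulr_ge0// ltW.
  have Seta : 0 <= S * eta by rewrite mulr_ge0// ltW.
  have K0 : 0 <= 2 * om * N + S * eta by rewrite addr_ge0// -mulrA mulr_ge0.
  apply: (@le_trans _ _ ((2 * om * N + S * eta) * rsum n (ind B))); last first.
    by rewrite ler_wpM2l.
  rewrite -rsumZ; apply: rsum_dist => z.
  set q := z *m U + t.
  have [qA|qA] := leP (enorm q) (A + 1); last first.
    have -> : (fun w => f w * bump e (w - q)) = (fun=> 0).
      apply/funext => w; have [wA|/fA ->] := leP (enorm w) A; last by rewrite mul0r.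
      rewrite bump_eq0 ?mulr0//; have := enormB w (w - q).
      by rewrite opprB addrC subrK; lra.
    rewrite (fA q) ?mulr0 ?subr0; last lra.
    by rewrite {1}/rsum big1// mulr0 normr0 mulr_ge0// /ind; case: ifP.
  have zB : enorm z <= B by have := norm_g z; rewrite -/q /B; lra.
  rewrite /ind zB mulr1.
  have NqN : `|rsum n (fun w => bump e (w - q)) - N| <= eta by apply: hn1; rewrite /B; lra.
  have : `|rsum n (fun w => f w * bump e (w - q)) - f q * rsum n (fun w => bump e (w - q))|
     <= om * rsum n (fun w => bump e (w - q)).
    rewrite -!rsumZ; apply: rsum_dist => w; rewrite -mulrBl normrM.
    rewrite (ger0_norm (bump_ge0 _ _)).
    have [qw|qw] := leP e (enorm (w - q)); first by rewrite bump_eq0// !mulr0.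
    by rewrite ler_wpM2r ?bump_ge0// ltW// fdel//; lra.
  have : `|f q * (rsum n (fun w => bump e (w - q)) - N)| <= S * eta.
    by rewrite normrM ler_pM.
  move: NqN; rewrite !ler_norml.
  set X := rsum n (fun w => f w * _); set Y := rsum n (fun w => bump e _).
  move=> /andP[y1 y2] /andP[a1 a2] /andP[b1 b2].
  have : om * Y <= om * (2 * N) by rewrite ler_wpM2l ?(ltW om0)//; lra.
  by move=> ?; apply/andP; split; nra.
(* The comparison is made after multiplication by [N]; the uniform bound [c <= N] lets the errors be
   absorbed. *)
rewrite -(ler_pM2r N0) -[X in _ * X <= _](gtr0_norm N0) -normrM mulrBl.
move: D1 D2; rewrite !ler_norml => /andP[? ?] /andP[? ?].
have : c * eps <= N * eps by rewrite ler_wpM2r// ltW.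
have : 2 * om * C * N <= eps / 2 * N by rewrite ler_wpM2r// ltW.
by move=> ? ?; apply/andP; split; nra.
Qed.

End AsymptoticInvariance.

(** * An isometry-invariant positive functional *)

Section HaarFunctional.
Variables (R : realType) (d : nat).
Local Notation vec := 'rV[R]_d.
Implicit Types (x y : vec) (f g : vec -> R) (n : nat).

(** Integration against Lebesgue measure up to a positive factor, axiomatised on compactly supported
    functions; [haar_bump] excludes the zero functional. *)
Record haar_functional (I : (vec -> R) -> R) : Prop := HaarFunctional {
  haarD : forall f g, cc f -> cc g -> I (fun x => f x + g x) = I f + I g;
  haarZ : forall c f, cc f -> I (fun x => c * f x) = c * I f;
  haar_le : forall f g, cc f -> cc g -> (forall x, f x <= g x) -> I f <= I g;
  haar_isom : forall f (U : 'M[R]_d) t, cc f -> U *m U^T = 1%:M ->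
    I (fun x => f (x *m U + t)) = I f;
  haar_bump : forall e, 0 < e -> 0 < I (bump e) }.

(** The ultrafilter refines the eventual filter, so whatever holds for all large [n], in particular
    asymptotic invariance, passes to the limit; linearity and monotonicity hold at each [n]. *)
Lemma haar_exists : exists I, haar_functional I.
Proof.
have [G [UG ooG]] := ultraFilterLemma eventually_filter.
have FG : ProperFilter G by exact: ultra_proper.
pose I f := xget 0 [set l : R | rsum n f @[n --> G] --> l].
have IE f : cc f -> rsum n f @[n --> G] --> I f.
  move=> cf; have [A A0 fA] := cc_supp cf; have [S S0 fS] := cc_bounded cf.
  pose K := S * (2 * A + 1) ^+ d.
  have [|l [_ cl]] := @segment_compact R (- K) K ((fun n => rsum n f) @ G) _.
    apply: (@filterE _ G) => n /=; rewrite in_itv /= -ler_norml.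
    exact: rsum_bound.
  have hl : rsum n f @[n --> G] --> l.
    (* A cluster point of an ultrafilter is a limit: otherwise the complement of a neighbourhood [V]
       would belong to it and yet meet [V]. *)
    move=> V lV; have [//|GV] := in_ultra_setVsetC ((fun n => rsum n f) @^-1` V) UG.
    by have [r []] := cl (~` V) V GV lV.
  exact: (xgetPex 0 (ex_intro [set l : R | rsum n f @[n --> G] --> l] l hl)).
have IU f l : cc f -> rsum n f @[n --> G] --> l -> I f = l.
  by move=> cf fl; apply: cvg_unique (IE f cf) fl; exact: norm_hausdorff.
exists I; split.
- move=> f g cf cg; apply: IU; first exact: ccD.
  under eq_fun do rewrite rsumD.
  exact: cvgD (IE _ cf) (IE _ cg).
- move=> c f cf; apply: IU; first exact: ccZ.
  under eq_fun do rewrite rsumZ.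
  exact: cvgM (cvg_cst _) (IE _ cf).
- move=> f g cf cg fg; apply: ler_cvg_to (IE _ cf) (IE _ cg) _.
  by apply: filterE => n; exact: rsum_le.
- move=> f U t cf hU; apply: IU; first exact: cc_isom.
  have := IE _ cf; set l := I f => /cvgrPdist_lt h.
  apply/cvgrPdist_lt => e e0; have e20 : 0 < e / 2 by lra.
  have [n0 hn0] := rsum_isom t hU cf e20.
  have : G [set n | (n0 <= n)%N] by apply: ooG; exists n0.
  have := h _ e20; apply: filterS2 => n /= h1 /hn0 h2.
  rewrite (_ : l - _ = (l - rsum n f) - (rsum n (fun x => f (x *m U + t)) - rsum n f)); last by ring.
  by apply: le_lt_trans (ler_normB _ _) _; lra.
- move=> e e0; apply: (@lt_le_trans _ _ (e / 2 * (e / 2 / d.+1%:R) ^+ d)).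
    by rewrite mulr_gt0 ?exprn_gt0 ?divr_gt0.
  set c := _ * _; have hc : (fun _ : nat => c) @ G --> c by exact: cvg_cst.
  apply: ler_cvg_to hc (IE _ (cc_bump d e)) _.
  apply: (@filterS _ G _ [set n | (Num.truncn e <= n)%N]); last by apply: ooG; exists (Num.truncn e).
  move=> n /= ne; apply: rsum_bump_ge => //.
  have /andP[_ /ltW h] := truncn_itv (ltW e0).
  by apply: le_trans h _; rewrite ler_nat.
Qed.

End HaarFunctional.

(** * Hausdorff neighbourhoods, nearest points and intersection with a ball *)

Section HausdorffNeighbourhoods.
Variables (R : realType) (d : nat).
Local Notation vec := 'rV[R]_d.
Implicit Types (x y n t : vec) (K L : set vec) (U : 'M[R]_d).

(** Hausdorff nearness through witnesses, free of the infimum. A distance below [del] implies it,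
    while it only gives back a distance at most [del]. *)
Definition hnear (del : R) K L :=
  (forall x, K x -> exists2 y, L y & enorm (x - y) < del) /\
  (forall y, L y -> exists2 x, K x & enorm (x - y) < del).

Lemma body_bounded K : convex_body K ->
  exists2 M : R, 0 <= M & forall x, K x -> enorm x <= M.
Proof.
move=> [_ [/compact_enormP[_ [M hM]] _]]; exists (Num.max 0 M); first by rewrite le_max lexx.
by move=> x /hM h; rewrite le_max h orbT.
Qed.

Lemma hnear_hausdorff (del : R) K L : 0 <= del -> hnear del K L ->
  hausdorff_dist K L <= del.
Proof.
move=> del0 [h1 h2]; apply: ge_inf; first by exists 0 => r [].
split=> //; split=> [x /h1[y Ly /ltW xy]|y /h2[x Kx /ltW xy]].
  by exists y.
by exists x.
Qed.

Lemma hausdorff_hnear (del : R) K L : convex_body K -> convex_body L ->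
  hausdorff_dist K L < del -> hnear del K L.
Proof.
move=> bK bL; have [M M0 hM] := body_bounded bK; have [M' M'0 hM'] := body_bounded bL.
have [[k Kk] _] := bK; have [[l Ll] _] := bL.
move=> /inf_lt[].
  exists (M + M'); split; first exact: addr_ge0.
  split=> [x Kx|y Ly].
    by exists l => //; rewrite (le_trans (enormB _ _))// lerD ?hM ?hM'.
  by exists k => //; rewrite (le_trans (enormB _ _))// lerD ?hM ?hM'.
move=> r [r0 [h1 h2]] rdel; split=> [x /h1[y Ly xy]|y /h2[x Kx xy]].
  by exists y => //; exact: le_lt_trans xy rdel.
by exists x => //; exact: le_lt_trans xy rdel.
Qed.

Lemma hnearW (a b : R) K L : a <= b -> hnear a K L -> hnear b K L.
Proof.
move=> ab [h1 h2]; split=> [x /h1[y Ly xy]|y /h2[x Kx xy]].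
  by exists y => //; exact: lt_le_trans xy ab.
by exists x => //; exact: lt_le_trans xy ab.
Qed.

Lemma hnear_translate (a b : R) K L x y : hnear a K L -> enorm (x - y) <= b ->
  hnear (a + b) (translate K x) (translate L y).
Proof.
move=> [h1 h2] xy.
have E u v : u + x - (v + y) = (u - v) + (x - y) by rewrite opprD addrACA.
split=> [_ [u /h1[v Lv uv] <-]|_ [v /h2[u Ku uv] <-]].
  exists (v + y); first by exists v.
  by rewrite E (le_lt_trans (enormD _ _))// ltr_leD.
exists (u + x); first by exists u.
by rewrite E (le_lt_trans (enormD _ _))// ltr_leD.
Qed.

(** The trace on convex bodies of the neighbourhood filter of [K], which makes the general limit
    theorems for filters available. *)
Definition hnbhs K : set_system (set vec) := fun P =>
  exists2 del : R, 0 < del & forall L, convex_body L -> hnear del K L -> P L.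

Global Instance hnbhs_filter K : Filter (hnbhs K).
Proof.
split; first by exists 1.
- move=> P Q [a a0 hP] [b b0 hQ]; exists (Num.min a b); first by rewrite lt_min a0.
  move=> L bL h; split; [apply: hP => //|apply: hQ => //]; apply: hnearW h.
    by rewrite ge_min lexx.
  by rewrite ge_min lexx orbT.
- by move=> P Q PQ [a a0 hP]; exists a => // L bL h; exact/PQ/hP.
Qed.

Definition hcont (F : set vec -> R) :=
  forall K, convex_body K -> F L @[L --> hnbhs K] --> F K.

Lemma hcontP (F : set vec -> R) : hcont F <->
  forall K, convex_body K -> forall e : R, 0 < e ->
    exists2 delta : R, 0 < delta &
      forall L, convex_body L -> hausdorff_dist K L < delta -> `|F L - F K| < e.
Proof.
split=> [h K bK e e0|h K bK].
  have := h K bK _ (nbhsx_ballx (F K) e e0); move=> [del del0 hd].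
  exists del => // L bL /(hausdorff_hnear bK bL) /(hd L bL).
  by rewrite /ball /= distrC.
move=> V /nbhs_ballP[e e0 eV]; have [del del0 hd] := h K bK e e0.
(* Halving compensates for the non-strict bound of [hnear_hausdorff]. *)
exists (del / 2); first by rewrite divr_gt0.
move=> L bL KL; apply: eV; rewrite /ball /= distrC; apply: hd => //.
by apply: le_lt_trans (hnear_hausdorff _ KL) _; lra.
Qed.

Lemma body_set1 x : convex_body [set x].
Proof.
split; first by exists x.
split; first exact: compact_set1.
by move=> u v -> -> t _ /=; rewrite -scalerDl addrC subrK scale1r.
Qed.

Lemma body_translate K t : convex_body K -> convex_body (translate K t).
Proof.
move=> [[k Kk] [/compact_enormP[/closed_enormP cK [M hM]] xK]].
split; first by exists (k + t); exists k.
split.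
  apply/compact_enormP; split.
    apply/closed_enormP => x h; exists (x - t); last by rewrite subrK.
    apply: cK => e /h[_ [y Ky <-] xy]; exists y => //.
    by rewrite addrAC -addrA -opprD.
  exists (M + enorm t) => _ [y Ky <-].
  by rewrite (le_trans (enormD _ _))// lerD2r hM.
move=> _ _ [u Ku <-] [v Kv <-] a a01; exists (a *: u + (1 - a) *: v).
  exact: xK.
by rewrite !scalerDr addrACA -scalerDl addrCA subrr addr0 scale1r.
Qed.

Lemma body_image U K : U *m U^T = 1%:M -> convex_body K -> convex_body (mx_image U K).
Proof.
move=> hU [[k Kk] [/compact_enormP[/closed_enormP cK [M hM]] xK]].
have hU' := mulmx1C hU.
have nU x : enorm (x *m U^T) = enorm x by rewrite enorm_orth// trmxK.
split; first by exists (k *m U^T); exists k.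
split.
  apply/compact_enormP; split.
    apply/closed_enormP => x h; exists (x *m U); last by rewrite -mulmxA hU mulmx1.
    apply: cK => e /h[_ [y Ky <-] xy]; exists y => //.
    by rewrite -nU mulmxBl -mulmxA hU mulmx1.
  by exists M => _ [y Ky <-]; rewrite nU hM.
move=> _ _ [u Ku <-] [v Kv <-] a a01; exists (a *: u + (1 - a) *: v).
  exact: xK.
by rewrite mulmxDl -!scalemxAl.
Qed.

Definition cball (r : R) : set vec := [set x | enorm x <= r].

Lemma body_cball K (r : R) x : convex_body K -> K x -> enorm x <= r ->
  convex_body (K `&` cball r).
Proof.
move=> [_ [/compact_enormP[/closed_enormP cK [M hM]] xK]] Kx xr.
split; first by exists x.
split.
  apply/compact_enormP; split; last by exists r => y [].
  have /compact_enormP[/closed_enormP cB _] := @eball_compact R d r.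
  apply/closed_enormP => y h; split.
    by apply: cK => e /h[z [Kz _] yz]; exists z.
  by apply: cB => e /h[z [_ Bz] yz]; exists z.
move=> u v [Ku Bu] [Kv Bv] a a01; split; first exact: xK.
have /andP[a0 a1] := a01; have a1' : 0 <= 1 - a by rewrite subr_ge0.
rewrite /cball /= (le_trans (enormD _ _))// !enormZ !ger0_norm//.
by move: Bu Bv; rewrite /cball /=; nra.
Qed.

Lemma np_exists K : convex_body K ->
  exists n, K n /\ forall x, K x -> enorm n <= enorm x.
Proof.
move=> [K0 [cK _]].
have [|n /set_mem Kn h] := @EVT_min_rV R d (@enorm R d) K K0 cK.
  by apply: continuous_subspaceT; apply/econtP; exact: econt_enorm.
by exists n; split=> // x Kx; apply: h; rewrite inE.
Qed.

(* Nearest point to the origin. *)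
Definition np K : vec :=
  xget 0 [set n | K n /\ forall x, K x -> enorm n <= enorm x].

Lemma npP K : convex_body K -> K (np K) /\ forall x, K x -> enorm (np K) <= enorm x.
Proof.
move=> bK; apply: (@xgetPex _ 0 [set n | K n /\ forall x, K x -> enorm n <= enorm x]).
by have [n hn] := np_exists bK; exists n.
Qed.

Lemma np_mem K : convex_body K -> K (np K).
Proof. by case/npP. Qed.

Lemma np_min K x : convex_body K -> K x -> enorm (np K) <= enorm x.
Proof. by case/npP => _; apply. Qed.

(** By convexity the midpoint of [x] and [np K] is in [K], so its norm is at least that of [np K];
    the parallelogram law converts this into a distance bound. *)
Lemma np_dist K x : convex_body K -> K x ->
  enorm (x - np K) ^+ 2 <= 2 * (enorm x ^+ 2 - enorm (np K) ^+ 2).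
Proof.
move=> bK Kx; rewrite parallelogram.
have h : K (2^-1 *: (x + np K)).
  rewrite scalerDr {2}(_ : 2^-1 = 1 - 2^-1 :> R); last by field.
  by apply: bK.2.2 => //; [exact: np_mem | apply/andP; split; lra].
have := np_min bK h; rewrite -(ler_pXn2r (n := 2)) ?nnegrE ?enorm_ge0//.
lra.
Qed.

Lemma np_unique K x : convex_body K -> K x -> enorm x <= enorm (np K) -> x = np K.
Proof.
move=> bK Kx h; apply/eqP; rewrite -subr_eq0; apply/eqP/enorm_eq0.
have := np_dist bK Kx; have e0 := enorm_ge0 (x - np K); have x0 := enorm_ge0 x.
have : enorm x ^+ 2 <= enorm (np K) ^+ 2 by rewrite lerXn2r ?nnegrE ?enorm_ge0.
by move=> h1 h2; rewrite leNgt; apply/negP => e1; have := exprn_gt0 2 e1; lra.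
Qed.

Lemma np_image U K : U *m U^T = 1%:M -> convex_body K ->
  np (mx_image U K) = np K *m U^T.
Proof.
move=> hU bK; apply/esym; apply: np_unique; first exact: body_image.
  by exists (np K) => //; exact: np_mem.
have nU x : enorm (x *m U^T) = enorm x by rewrite enorm_orth// trmxK// mulmx1C.
have [y Ky <-] := np_mem (body_image hU bK).
by rewrite !nU np_min.
Qed.

Lemma near_np K (e : R) : convex_body K -> 0 < e ->
  exists2 del, 0 < del & forall x, K x -> enorm x <= enorm (np K) + del ->
    enorm (x - np K) < e.
Proof.
move=> bK e0; have n0 := enorm_ge0 (np K); set a := enorm (np K) in n0 *.
(* For [del <= 1], [np_dist] gives the squared distance at most
   [2 del (2a + del) <= 2 del (2a + 1)], which this choice makes at most [e^2 / 2]. *)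
pose c := e ^+ 2 / (4 * (2 * a + 1)).
have c0 : 0 < c by rewrite divr_gt0 ?exprn_gt0// mulr_gt0//; lra.
exists (Num.min 1 c); first by rewrite lt_min ltr01.
move=> x Kx; set del := Num.min 1 c => xd.
have d0 : 0 < del by rewrite lt_min ltr01.
have d1 : del <= 1 by rewrite ge_min lexx.
have dc : del * (4 * (2 * a + 1)) <= e ^+ 2.
  have a0 : 0 < 4 * (2 * a + 1) by rewrite mulr_gt0//; lra.
  by rewrite -ler_pdivlMr// -/c ge_min lexx orbT.
rewrite -(ltr_pXn2r (n := 2)) ?nnegrE ?enorm_ge0 ?(ltW e0)//.
apply: le_lt_trans (np_dist bK Kx) _; rewrite -/a.
have x0 := enorm_ge0 x.
have : enorm x ^+ 2 <= (a + del) ^+ 2 by rewrite lerXn2r ?nnegrE// addr_ge0// ltW.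
by move=> h; nra.
Qed.

(** A point of [K] close to [np L] has almost minimal norm in [K], hence is close to [np K] by
    [near_np]. *)
Lemma np_cvg K : convex_body K -> np L @[L --> hnbhs K] --> np K.
Proof.
move=> bK V /nbhs_enormP[e e0 eV].
have e20 : 0 < e / 2 by rewrite divr_gt0.
have [del del0 hd] := near_np bK e20.
exists (Num.min (e / 2) (del / 2)); first by rewrite lt_min e20 divr_gt0.
move=> L bL [h1 h2]; apply: eV.
set m := Num.min _ _ in h1 h2.
have m1 : m <= e / 2 by rewrite ge_min lexx.
have m2 : m <= del / 2 by rewrite ge_min lexx orbT.
have [x Kx xn'] := h2 _ (np_mem bL).
have [y Ly ny] := h1 _ (np_mem bK).
have := np_min bL Ly; have := enormD (y - np K) (np K); rewrite subrK enorm_sub.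
have := enormD (x - np L) (np L); rewrite subrK => a1 a2 a3.
have /(hd x Kx) : enorm x <= enorm (np K) + del by lra.
have := enorm_dist_trans x (np K) (np L); rewrite (enorm_sub (np K) x).
lra.
Qed.

Lemma hnbhs_set1 (F : set vec -> R) x : F L @[L --> hnbhs [set x]] --> F [set x] ->
  F [set y] @[y --> x] --> F [set x].
Proof.
move=> h V /h[del del0 hd]; apply/nbhs_enormP; exists del => // y xy.
apply: hd; first exact: body_set1.
by split=> [_ ->|_ ->]; [exists y|exists x].
Qed.

(** Continuity of intersection with a ball, among bodies that still meet it. If [K] only touches the
    ball, everything shrinks to [np K]. Otherwise [np K] is interior to the ball, and pulling points
    of [K] slightly towards it makes room for the Hausdorff error. *)
Lemma cball_cvg K (rho : R) (P : set (set vec)) : convex_body K -> enorm (np K) <= rho ->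
  hnbhs (K `&` cball rho) P ->
  hnbhs K (fun L => enorm (np L) <= rho -> P (L `&` cball rho)).
Proof.
move=> bK; rewrite le_eqVlt => /orP[/eqP nr|nr] [e e0 eP].
  have e20 : 0 < e / 2 by rewrite divr_gt0.
  have [del del0 hd] := near_np bK e20.
  exists (Num.min (e / 2) del); first by rewrite lt_min e20.
  move=> L bL; set m := Num.min _ _ => -[h1 h2] Lr.
  have m1 : m <= e / 2 by rewrite ge_min lexx.
  have m2 : m <= del by rewrite ge_min lexx orbT.
  have near y : L y -> enorm y <= rho -> enorm (np K - y) < e.
    move=> Ly yr; have [x Kx xy] := h2 y Ly.
    have := enormD (x - y) y; rewrite subrK => a1.
    have /(hd x Kx) : enorm x <= enorm (np K) + del by rewrite nr; lra.
    by have := enorm_dist_trans x (np K) y; rewrite (enorm_sub (np K) x); lra.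
  have bL' := body_cball bL (np_mem bL) Lr.
  apply: eP => //; split=> [x [Kx xr]|y [Ly yr]].
    have -> : x = np K by apply: np_unique; rewrite ?nr.
    by exists (np L); [split=> //; exact: np_mem | apply: near => //; exact: np_mem].
  exists (np K); last exact: near.
  by split; [exact: np_mem | rewrite /cball /= nr].
set a := enorm (np K) in nr *; pose g := rho - a.
have a0 : 0 <= a by exact: enorm_ge0.
have g0 : 0 < g by rewrite subr_gt0.
(* Chosen so that the perturbation [del] plus the pull [t (2 rho + 1)], with [t = del / g], is at
   most [e / 2]. *)
pose c := e / 2 / (1 + (2 * rho + 1) / g).
have q0 : 0 < 1 + (2 * rho + 1) / g.
  by rewrite ltr_wpDr// divr_ge0 ?(ltW g0)//; lra.
have c0 : 0 < c by rewrite !divr_gt0.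
exists (Num.min c (Num.min 1 g)); first by rewrite !lt_min c0 ltr01.
move=> L bL; set del := Num.min _ _ => -[h1 h2] Lr.
have d0 : 0 < del by rewrite !lt_min c0 ltr01.
have dc : del <= c by rewrite ge_min lexx.
have d1 : del <= 1 by rewrite !ge_min lexx !orbT.
have dg : del <= g by rewrite !ge_min lexx !orbT.
(* Pulling by the fraction [t] towards [np K] lowers the norm bound [rho] by [t g = del], exactly
   the possible Hausdorff error. *)
pose t := del / g.
have t0 : 0 < t by rewrite divr_gt0.
have t1 : t <= 1 by rewrite ler_pdivrMr// mul1r.
have tg : t * g = del by rewrite mulfVK// gt_eqF.
have small : del + t * (2 * rho + 1) < e.
  rewrite (_ : del + _ = del * (1 + (2 * rho + 1) / g)); last by rewrite /t; ring.
  by apply: (@le_lt_trans _ _ (e / 2)); [rewrite -ler_pdivlMr | lra].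
have seg x : K x -> K ((1 - t) *: x + t *: np K).
  move=> Kx; rewrite addrC -{1}[t](subKr 1) -{2}[t](subKr 1) opprB addrCA subrr addr0.
  by apply: bK.2.2; [exact: np_mem | by [] | rewrite ltW].
have segn x : enorm ((1 - t) *: x + t *: np K) <= (1 - t) * enorm x + t * a.
  by rewrite (le_trans (enormD _ _))// !enormZ !ger0_norm ?subr_ge0// ltW.
have segd x : enorm (x - ((1 - t) *: x + t *: np K)) <= t * (enorm x + a).
  rewrite (_ : x - _ = t *: (x - np K)); last first.
    by rewrite scalerBl scale1r scalerBr opprD opprB addrA addrCA subrr addr0.
  by rewrite enormZ gtr0_norm// ler_wpM2l ?(ltW t0)// enormB.
apply: eP; first exact: body_cball (np_mem bL) Lr.
split=> [x [Kx xr]|y [Ly yr]].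
  have [y Ly xy] := h1 _ (seg x Kx).
  have := segn x; have := segd x; set xt := _ + t *: np K in xy *.
  move: xr; rewrite /cball /= => xr sd sn.
  have : enorm xt <= rho - del by rewrite -tg /g; nra.
  have := enormB xt (xt - y); rewrite opprB addrC subrK => yn xtn.
  exists y; first by split => //=; rewrite /cball /=; lra.
  by have := enorm_dist_trans xt x y; nra.
have [x Kx xy] := h2 _ Ly.
have := segn x; have := segd x; set xt := (1 - t) *: x + _ => sd sn.
have := enormD (x - y) y; rewrite subrK => xn.
move: yr; rewrite /cball /= => yr.
have tdel : 0 <= t * del by rewrite mulr_ge0// ltW.
exists xt.
  split; first exact: seg.
  rewrite /cball /= (le_trans sn)//.
  by move: tg; rewrite /g; nra.
have := enorm_dist_trans x xt y; rewrite (enorm_sub xt x).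
have : t * (enorm x + a) <= t * (2 * rho + 1).
  by rewrite ler_wpM2l ?(ltW t0)//; lra.
lra.
Qed.

End HausdorffNeighbourhoods.

(** * Truncating a valuation to a ball without losing continuity *)

Section Truncation.
Variables (R : realType) (d : nat).
Local Notation vec := 'rV[R]_d.
Implicit Types (x y n t : vec) (K L : set vec) (U : 'M[R]_d).

(** Connectedness of a segment: its last point in [K1] is either [y] or a limit of later points,
    which lie in [K2]; closedness puts it in both. *)
Lemma segment_meet K1 K2 x y : closed K1 -> closed K2 -> K1 x -> K2 y ->
  (forall t : R, 0 <= t <= 1 -> (K1 `|` K2) (t *: y + (1 - t) *: x)) ->
  exists t : R, [/\ 0 <= t <= 1, K1 (t *: y + (1 - t) *: x) & K2 (t *: y + (1 - t) *: x)].
Proof.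
move=> /closed_enormP c1 /closed_enormP c2 K1x K2y h.
pose s (t : R) := t *: y + (1 - t) *: x.
have sd a b : enorm (s a - s b) = `|a - b| * enorm (y - x).
  rewrite -enormZ; congr enorm; rewrite /s scalerBr !scalerBl !scale1r.
  by apply/rowP => i; rewrite !mxE; ring.
pose A := [set t : R | 0 <= t <= 1 /\ K1 (s t)].
have A0 : A 0 by split; [rewrite lexx ler01 | rewrite /s scale0r add0r subr0 scale1r].
have hA : has_sup A by split; [exists 0 | exists 1 => t [/andP[]]].
pose b := sup A.
have b0 : 0 <= b by apply: ub_le_sup => //; exact: hA.2.
have b1 : b <= 1 by apply: ge_sup; [exists 0 | move=> t [/andP[]]].
have N0 := enorm_ge0 (y - x); set N := enorm (y - x) in sd N0 *.
have K1b : K1 (s b).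
  apply: c1 => e e0; have e10 : 0 < e / (N + 1) by rewrite divr_gt0// ltr_wpDl.
  have [t At bt] := sup_adherent e10 hA.
  have tb : t <= b by apply: ub_le_sup => //; exact: hA.2.
  exists (s t); first exact: At.2.
  have : (b - t) * (N + 1) < e.
    by rewrite -ltr_pdivlMr ?ltr_wpDl//; move: bt; rewrite -/b; lra.
  by rewrite sd ger0_norm ?subr_ge0//; apply: le_lt_trans; rewrite ler_wpM2l ?subr_ge0//; lra.
exists b; split=> //; first by rewrite b0.
move: b1; rewrite le_eqVlt => /orP[/eqP ->|b1]; first by rewrite scale1r subrr scale0r addr0.
apply: c2 => e e0; have e10 : 0 < e / (N + 1) / 2 by rewrite !divr_gt0// ltr_wpDl.
pose t := Num.min 1 (b + e / (N + 1) / 2).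
have bt : b < t by rewrite lt_min b1 ltrDl.
have t1 : t <= 1 by rewrite ge_min lexx.
have te : t <= b + e / (N + 1) / 2 by rewrite ge_min lexx orbT.
have t01 : 0 <= t <= 1 by rewrite t1 andbT (le_trans b0)// ltW.
have [K1t|K2t] := h t t01.
  have : t <= b by apply: ub_le_sup; [exact: hA.2 | split].
  by rewrite leNgt bt.
exists (s t) => //; rewrite sd distrC ger0_norm ?subr_ge0 ?(ltW bt)//.
have : (t - b) * (N + 1) < e.
  by rewrite -ltr_pdivlMr ?ltr_wpDl//; move: e10; lra.
by apply: le_lt_trans; rewrite ler_wpM2l ?subr_ge0 ?(ltW bt)//; lra.
Qed.

(** The segment between the two nearest points meets the intersection at a point of norm at most
    that of [np K2], which must be [np K2] by uniqueness. Consequently any function of the nearest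
    point is a valuation. *)
Lemma np_union K1 K2 : convex_body K1 -> convex_body K2 -> convex_body (K1 `|` K2) ->
  enorm (np K1) <= enorm (np K2) ->
  [/\ convex_body (K1 `&` K2), np (K1 `|` K2) = np K1 & np (K1 `&` K2) = np K2].
Proof.
move=> b1 b2 b12 n12.
have cl1 : closed K1 by have /compact_enormP[] := b1.2.1.
have cl2 : closed K2 by have /compact_enormP[] := b2.2.1.
have [|t [t01]] := segment_meet cl1 cl2 (np_mem b1) (np_mem b2) _.
  move=> t t01; apply: b12.2.2 => //; [right|left]; exact: np_mem.
set z := _ + _ => K1z K2z.
have zn : enorm z <= enorm (np K2).
  have /andP[t0 t1] := t01; have t1' : 0 <= 1 - t by rewrite subr_ge0.
  by rewrite /z (le_trans (enormD _ _))// !enormZ !ger0_norm//; nra.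
have zE : z = np K2 by exact: np_unique.
have bI : convex_body (K1 `&` K2).
  split; first by exists z.
  split.
    apply: (subclosed_compact (closedI cl1 cl2) b1.2.1); exact: subIsetl.
  move=> u v [u1 u2] [v1 v2] s s01; split; [exact: b1.2.2|exact: b2.2.2].
split=> //.
  apply/esym/np_unique => //; first by left; exact: np_mem.
  have [h|h] := np_mem b12; first exact: np_min.
  by rewrite (le_trans n12)// np_min.
apply/esym/np_unique; rewrite -?zE//.
by rewrite zE np_min//; have [] := np_mem bI.
Qed.

Definition rvaluation (F : set vec -> R) := forall K1 K2, convex_body K1 ->
  convex_body K2 -> convex_body (K1 `|` K2) ->
  F (K1 `|` K2) + F (K1 `&` K2) = F K1 + F K2.

Definition rinvariant (so : bool) (F : set vec -> R) := forall U, in_G so U ->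
  forall K, convex_body K -> F (mx_image U K) = F K.

(* Restricts [F] to bodies meeting the ball of radius [r + 1]; the term at the
   nearest point cancels the jump at the boundary. *)
Definition trunc_val (F : set vec -> R) (r : R) K : R :=
  if enorm (np K) <= r + 1 then
    F (K `&` cball (r + 1)) - Num.max 0 (enorm (np K) - r) * F [set np K]
  else 0.

Lemma trunc_val_id F (r : R) K : convex_body K -> (forall x, K x -> enorm x <= r) ->
  trunc_val F r K = F K.
Proof.
move=> bK h; have nr := h _ (np_mem bK); rewrite /trunc_val ifT; last lra.
rewrite (max_idPl _) ?subr_le0// mul0r subr0; congr F; apply/seteqP; split=> x; first by case.
by move=> Kx; split=> //=; rewrite /cball /=; have := h x Kx; lra.
Qed.

Lemma trunc_val_eq0 F (r M : R) K y : convex_body K -> (forall x, K x -> enorm x <= M) ->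
  r + 1 + M < enorm y -> trunc_val F r (translate K y) = 0.
Proof.
move=> bK h yr; rewrite /trunc_val ifF//; apply/negbTE; rewrite -ltNge.
have [x Kx <-] := np_mem (body_translate y bK).
have := enormB (x + y) x; rewrite addrAC subrr add0r; have := h x Kx; lra.
Qed.

(** If both bodies meet the ball, the property of [F] applies to the cut bodies and the correction
    terms match by [np_union]. If only [K1] does, the cut union is the cut [K1] and the intersection
    contributes 0. *)
Lemma trunc_val_valuation F (r : R) : rvaluation F -> rvaluation (trunc_val F r).
Proof.
move=> vF K1 K2.
wlog n12 : K1 K2 / enorm (np K1) <= enorm (np K2).
  move=> h b1 b2 b12; have [/h|/ltW/h] := leP (enorm (np K1)) (enorm (np K2)).
    exact.
  by rewrite setUC setIC [RHS]addrC; apply=> //; rewrite setUC.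
move=> b1 b2 b12; have [bI nU nI] := np_union b1 b2 b12 n12.
rewrite /trunc_val nU nI.
have [h2|h2] := leP (enorm (np K2)) (r + 1).
  have h1 := le_trans n12 h2; rewrite h1.
  have := vF (K1 `&` cball (r + 1)) (K2 `&` cball (r + 1)).
  have c1 := body_cball b1 (np_mem b1) h1; have c2 := body_cball b2 (np_mem b2) h2.
  rewrite -setIUl setIACA setIid; move=> /(_ c1 c2) e.
  have {e}e := e (body_cball b12 (or_introl (np_mem b1)) h1).
  by move: e; lra.
have [h1|//] := leP (enorm (np K1)) (r + 1).
congr (F _ - _ + _); rewrite setIUl (_ : K2 `&` _ = set0) ?setU0//.
apply/seteqP; split=> // x [K2x]; rewrite /cball /= => xr.
by have := np_min b2 K2x; lra.
Qed.

Lemma trunc_val_invariant so F (r : R) : rinvariant so F -> rinvariant so (trunc_val F r).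
Proof.
move=> iF U GU K bK; have hU := GU.1.
have nU x : enorm (x *m U^T) = enorm x by rewrite enorm_orth// trmxK// mulmx1C.
rewrite /trunc_val np_image// nU; case: ifP => // nr.
rewrite -(iF U GU _ (body_set1 (np K))) -(iF U GU _ (body_cball bK (np_mem bK) nr)).
congr (F _ - _ * F _); apply/seteqP; split=> x.
- by move=> [[y Ky <-]]; rewrite /cball /= nU => yr; exists y.
- by move=> [y [Ky yr] <-]; split; [exists y | rewrite /cball /= nU].
- by move=> ->; exists (np K).
- by move=> [y -> <-].
Qed.

Lemma cvg_max0 (T : Type) (G : set_system T) {FG : Filter G} (f : T -> R) (l : R) :
  f @ G --> l -> Num.max 0 (f z) @[z --> G] --> Num.max 0 l.
Proof.
move=> /cvgrPdist_lt h; apply/cvgrPdist_lt => e /h; apply: filterS => z.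
by rewrite !ltr_norml; case: (leP 0 l) => ?; case: (leP 0 (f z)) => ?; lra.
Qed.

Lemma trunc_val_hcont F (r : R) : hcont F -> hcont (trunc_val F r).
Proof.
move=> cF K bK.
have cn := np_cvg bK.
have cen : enorm (np L) @[L --> hnbhs K] --> enorm (np K).
  by apply: cvg_comp cn _; move: (np K); apply/econtP; exact: econt_enorm.
have [nr|nr] := leP (enorm (np K)) (r + 1); last first.
  move=> V; rewrite {1}/trunc_val leNgt nr /= => V0.
  have : hnbhs K [set L | r + 1 < enorm (np L)].
    exact: (cvgr_gt _ cen _ nr).
  apply: filterS => L /= Lr; rewrite /trunc_val leNgt Lr /=.
  exact: nbhs_singleton.
pose B := cball (r + 1) : set vec.
(* For [L] missing the ball, the intersection is replaced by its expected limit, so that the limit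
   is meaningful along the whole neighbourhood filter. *)
pose H L := if enorm (np L) <= r + 1 then F (L `&` B) else F (K `&` B).
have cH : H L @[L --> hnbhs K] --> F (K `&` B).
  have bKB := body_cball bK (np_mem bK) nr.
  move=> V FV; have := cball_cvg bK nr (cF _ bKB V FV).
  apply: filterS => L /= hL; rewrite /H; case: ifP => [/hL//|_].
  exact: nbhs_singleton.
have cM : H L - Num.max 0 (enorm (np L) - r) * F [set np L] @[L --> hnbhs K] -->
    F (K `&` B) - Num.max 0 (enorm (np K) - r) * F [set np K].
  apply: cvgB => //; apply: cvgM.
    by apply: cvg_max0; apply: cvgB => //; exact: cvg_cst.
  have := hnbhs_set1 (cF _ (body_set1 (np K))).
  exact: cvg_comp cn.
move=> V TV.
have TE : trunc_val F r K = F (K `&` B) - Num.max 0 (enorm (np K) - r) * F [set np K].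
  by rewrite /trunc_val nr.
have := cM V; rewrite -TE => /(_ TV) hV.
move: nr; rewrite le_eqVlt => /orP[/eqP nr|nr].
  (* For a touching body the cut is [[set np K]] and the weight is 1, so the two terms cancel; this
     agrees with the value 0 of nearby bodies that miss the ball. *)
  have T0 : trunc_val F r K = 0.
    rewrite TE nr addrAC subrr add0r (max_idPr _) ?ler01// mul1r; apply/eqP; rewrite subr_eq0.
    apply/eqP; congr F; apply/seteqP; split=> x.
      by move=> [Kx xr]; apply: np_unique => //; rewrite nr.
    by move=> ->; split; [exact: np_mem | rewrite /B /cball /= nr].
  change (hnbhs K (fun L => V (trunc_val F r L))).
  change (hnbhs K (fun L => V (H L - Num.max 0 (enorm (np L) - r) * F [set np L]))) in hV.
  apply: filterS hV => L /=; rewrite /H /trunc_val; case: ifP => // _ _.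
  by have := nbhs_singleton TV; rewrite T0.
have hr : hnbhs K [set L | enorm (np L) < r + 1].
  exact: (cvgr_lt _ cen _ nr).
change (hnbhs K (fun L => V (trunc_val F r L))).
change (hnbhs K (fun L => V (H L - Num.max 0 (enorm (np L) - r) * F [set np L]))) in hV.
apply: filterS2 hV hr => L /= h1 h2.
by move: h1; rewrite /H /trunc_val (ltW h2).
Qed.

End Truncation.

(** * Orbits of a body under translations *)

Section Translates.
Variables (R : realType) (d : nat).
Local Notation vec := 'rV[R]_d.
Implicit Types (x y z : vec) (K L : set vec) (U : 'M[R]_d) (T : set vec -> R).

Lemma translateU K L x : translate (K `|` L) x = translate K x `|` translate L x.
Proof. exact: image_setU. Qed.

Lemma translateI K L x : translate (K `&` L) x = translate K x `&` translate L x.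
Proof.
apply/seteqP; split=> z; first by move=> [y [Ky Ly] <-]; split; exists y.
by move=> [[y Ky <-] [y' Ly' /addIr E]]; exists y => //; split=> //; rewrite -E.
Qed.

Lemma translateD K x y : translate (translate K x) y = translate K (x + y).
Proof.
apply/seteqP; split=> z.
  by move=> [_ [k Kk <-] <-]; exists k => //; rewrite addrA.
by move=> [k Kk <-]; exists (k + x); [exists k | rewrite addrA].
Qed.

Lemma translate0 K : translate K 0 = K.
Proof.
apply/seteqP; split=> z; first by move=> [k Kk <-]; rewrite addr0.
by exists z => //; rewrite addr0.
Qed.

Lemma translate_image U K y : U *m U^T = 1%:M ->
  translate (mx_image U K) y = mx_image U (translate K (y *m U)).
Proof.
move=> hU; have E k : k *m U^T + y = (k + y *m U) *m U^T.
  by rewrite mulmxDl -mulmxA hU mulmx1.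
apply/seteqP; split=> z.
  by move=> [_ [k Kk <-] <-]; exists (k + y *m U); [exists k | rewrite E].
by move=> [_ [k Kk <-] <-]; exists (k *m U^T); [exists k | rewrite E].
Qed.

Lemma hnear_refl (a : R) K : 0 < a -> hnear a K K.
Proof. by move=> a0; split=> x Kx; exists x; rewrite // subrr enorm0. Qed.

Lemma hnear_trans (a b : R) K L N : hnear a K L -> hnear b L N -> hnear (a + b) K N.
Proof.
move=> [h1 h2] [h3 h4]; split=> [x /h1[y /h3[z Nz yz] xy]|z /h4[y /h2[x Kx xy] yz]].
  by exists z => //; rewrite (le_lt_trans (enorm_dist_trans y x z))// ltrD.
by exists x => //; rewrite (le_lt_trans (enorm_dist_trans y x z))// ltrD.
Qed.

Lemma hnear_bound (a M : R) K L : hnear a K L -> (forall x, K x -> enorm x <= M) ->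
  forall x, L x -> enorm x <= M + a.
Proof.
move=> [_ h] hM y /h[x Kx xy]; have := hM x Kx.
by have := enormB x (x - y); rewrite opprB addrC subrK; lra.
Qed.

Lemma body_inter K L : convex_body K -> convex_body L -> convex_body (K `|` L) ->
  convex_body (K `&` L).
Proof.
move=> bK bL bKL; have [h|/ltW h] := leP (enorm (np K)) (enorm (np L)).
  by have [] := np_union bK bL bKL h.
by rewrite setIC; rewrite setUC in bKL; have [] := np_union bL bK bKL h.
Qed.

Lemma hcont_at T K (e : R) : hcont T -> convex_body K -> 0 < e ->
  exists2 del : R, 0 < del & forall L, convex_body L -> hnear del K L -> `|T K - T L| < e.
Proof.
by move=> cT bK e0; have [del del0 h] := cT K bK _ (nbhsx_ballx (T K) e e0); exists del.
Qed.

Lemma econt_orbit T K : hcont T -> convex_body K -> econt (fun y => T (translate K y)).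
Proof.
move=> cT bK x e e0; have [del del0 h] := hcont_at cT (body_translate x bK) e0.
exists (del / 2); first by rewrite divr_gt0.
move=> y /ltW xy; apply: h; first exact: body_translate.
have del20 : 0 < del / 2 by rewrite divr_gt0.
by have := hnear_translate (hnear_refl K del20) xy; apply: hnearW; lra.
Qed.

(** Continuity at finitely many translates of [K] suffices: half of each radius pays for moving [y]
    to a centre, the other half for replacing [K] by [L]. *)
Lemma hcont_unif T K (A e : R) : hcont T -> convex_body K -> 0 < e ->
  exists2 del : R, 0 < del & forall L, convex_body L -> hnear del K L ->
    forall y, enorm y <= A -> `|T (translate K y) - T (translate L y)| < e.
Proof.
move=> cT bK e0; have e20 : 0 < e / 2 by rewrite divr_gt0.
pose del x := sval (cid2 (hcont_at cT (body_translate x bK) e20)).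
have del0 x : 0 < del x / 2 by rewrite divr_gt0// /del; case: cid2.
have delP x L : convex_body L -> hnear (del x) (translate K x) L ->
    `|T (translate K x) - T L| < e / 2.
  by rewrite /del; case: cid2 => //= r _ h; exact: h.
have [s sP] := eball_cover (eball_compact d A) del0.
have [m m0 hm] := seq_lower s del0.
exists m => // L bL KL y yA; have [x xs /ltW xy] := sP y yA.
have near N : convex_body N -> hnear m K N ->
    `|T (translate K x) - T (translate N y)| < e / 2.
  move=> bN KN; apply: delP; first exact: body_translate.
  by have := hnear_translate KN xy; apply: hnearW; have := hm x xs; lra.
have := near K bK (hnear_refl K m0); have := near L bL KL.
rewrite distrC => h1 h2.
have := ler_normD (T (translate K y) - T (translate K x)) (T (translate K x) - T (translate L y)).
rewrite addrA subrK => h3.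
by move: h1 h2; rewrite distrC => h1; rewrite distrC => h2; lra.
Qed.

End Translates.

(** * Closure properties of polynomials of bounded degree *)

Section Polynomials.
Variables (R : realType) (d : nat).
Local Notation vec := 'rV[R]_d.
Implicit Types (f g : vec -> R[i]) (l : nat).

Lemma poly_le_add f g l : is_poly_le f l -> is_poly_le g l -> is_poly_le (fun x => f x + g x) l.
Proof.
move=> [c hc] [c' hc']; exists (fun a => c a + c' a) => x.
by rewrite hc hc' -big_split; apply: eq_bigr => a _; rewrite mulrDl.
Qed.

Lemma poly_le_scale (k : R[i]) f l : is_poly_le f l -> is_poly_le (fun x => k * f x) l.
Proof.
move=> [c hc]; exists (fun a => k * c a) => x.
by rewrite hc mulr_sumr; apply: eq_bigr => a _; rewrite mulrA.
Qed.

Lemma poly_le_monomial (k : R[i]) (m : 'I_d -> nat) l : (\sum_i m i <= l)%N ->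
  is_poly_le (fun x : vec => k * \prod_i ((x ord0 i)%:C)%C ^+ m i) l.
Proof.
move=> ml; have mi i : (m i < l.+1)%N.
  by rewrite ltnS (leq_trans _ ml)// (bigD1 i)//= leq_addr.
pose a0 : {ffun 'I_d -> 'I_l.+1} := [ffun i => Ordinal (mi i)].
exists (fun a => if a == a0 then k else 0) => x.
rewrite (bigD1 a0) /=; last first.
  by rewrite (eq_bigr m)// => i _; rewrite ffunE.
rewrite eqxx; set Z := (X in _ + X); have -> : Z = 0.
  by apply: big1 => a /andP[_ /negbTE ne]; rewrite ne mul0r.
rewrite addr0.
by congr (_ * _); apply: eq_bigr => i _; rewrite ffunE.
Qed.

Lemma poly_le_cst (k : R[i]) l : is_poly_le (fun _ : vec => k) l.
Proof.
have := @poly_le_monomial k (fun=> 0%N) l; rewrite big1// => /(_ isT).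
by congr is_poly_le; apply/funext => x; rewrite big1 ?mulr1// => i _; rewrite expr0.
Qed.

Lemma poly_le_sum (J : Type) (s : seq J) (P : pred J) (F : J -> vec -> R[i]) l :
  (forall j, P j -> is_poly_le (F j) l) -> is_poly_le (fun x => \sum_(j <- s | P j) F j x) l.
Proof.
move=> h; elim: s => [|j s IH].
  by under eq_fun do rewrite big_nil; exact: poly_le_cst.
under eq_fun do rewrite big_cons.
by case Pj : (P j) => //; apply: poly_le_add => //; exact: h.
Qed.

(** The type of exponents depends on the degree bound, so each monomial has to be re-indexed. *)
Lemma poly_le_widen f l l' : (l <= l')%N -> is_poly_le f l -> is_poly_le f l'.
Proof.
move=> ll' [c hc]; rewrite (funext hc); apply: poly_le_sum => a al.
by apply: poly_le_monomial; exact: leq_trans ll'.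
Qed.

Lemma poly_le_mulX f i l : is_poly_le f l ->
  is_poly_le (fun x => ((x ord0 i)%:C)%C * f x) l.+1.
Proof.
move=> [c hc].
have -> : (fun x : vec => ((x ord0 i)%:C)%C * f x) = fun x =>
    \sum_(a : {ffun 'I_d -> 'I_l.+1} | (\sum_j (a j : nat) <= l)%N)
      c a * \prod_j ((x ord0 j)%:C)%C ^+ (a j + (j == i)).
  apply/funext => x; rewrite hc mulr_sumr; apply: eq_bigr => a _.
  rewrite mulrCA; congr (_ * _); rewrite (bigD1 i)//= [RHS](bigD1 i)//= eqxx addn1 exprS mulrA.
  by congr (_ * _); apply: eq_bigr => j /negbTE ->; rewrite addn0.
apply: poly_le_sum => a al; apply: poly_le_monomial.
rewrite big_split /= (bigD1 i (F := fun j => nat_of_bool (j == i)))//= eqxx.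
set Z := (X in (_ + (_ + X))%N); have -> : Z = 0%N by apply: big1 => j /negbTE ->.
by rewrite addn0 addn1 ltnS.
Qed.

End Polynomials.

(** * Convolution with powers of the Landau kernel *)

Section Smoothing.
Variables (R : realType) (d : nat) (I : ('rV[R]_d -> R) -> R).
Hypothesis HI : haar_functional I.
Local Notation vec := 'rV[R]_d.
Implicit Types (x y z : vec) (f g h w : vec -> R) (K L : set vec) (U : 'M[R]_d).
Implicit Types (T : set vec -> R) (k : nat).

Lemma haarB f g : cc f -> cc g -> I (fun x => f x - g x) = I f - I g.
Proof.
move=> cf cg; rewrite -mulN1r -(haarZ HI)// -(haarD HI)//; last exact: ccZ.
by congr I; apply/funext => x; rewrite mulN1r.
Qed.

Lemma haar0 : I (fun=> 0) = 0.
Proof. by have := haarZ HI 0 (cc0 R d); rewrite !mul0r. Qed.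

Lemma haar_ge0 f : cc f -> (forall x, 0 <= f x) -> 0 <= I f.
Proof. by move=> cf f0; rewrite -haar0; apply: haar_le => //; exact: cc0. Qed.

Lemma haar_dist f g h : cc f -> cc g -> cc h -> (forall x, `|f x - g x| <= h x) ->
  `|I f - I g| <= I h.
Proof.
move=> cf cg ch fgh; rewrite -haarB//.
have cfg : cc (fun x => f x - g x).
  have := ccD cf (ccZ (-1) cg); congr cc; apply/funext => x; by rewrite mulN1r.
rewrite ler_norml -[- I h]mulN1r -(haarZ HI)//; apply/andP; split.
  apply: haar_le => //; first exact: ccZ.
  by move=> x; have := fgh x; rewrite ler_norml mulN1r => /andP[].
apply: haar_le => // x.
by have := fgh x; rewrite ler_norml => /andP[].
Qed.

Lemma haar_sum (J : Type) (s : seq J) (F : J -> vec -> R) : (forall j, cc (F j)) ->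
  I (fun x => \sum_(j <- s) F j x) = \sum_(j <- s) I (F j).
Proof.
move=> cF; elim: s => [|j s IH].
  by rewrite big_nil -[RHS]haar0; congr I; apply/funext => x; rewrite big_nil.
rewrite big_cons -IH -(haarD HI)//; last exact: cc_sum.
by congr I; apply/funext => x; rewrite big_cons.
Qed.

(** No cutoff is applied, so that this is a polynomial on the whole space; it is negative outside
    the ball of radius [M], where orbits must therefore vanish. *)
Definition landau (M : R) y : R := 1 - enorm y ^+ 2 / M ^+ 2.

Lemma econt_landau_sub (M : R) x : econt (fun y => landau M (y - x)).
Proof.
have cn : econt (fun y => enorm (y - x)).
  apply: (@econt_lip _ _ _ 1) => u v; rewrite mul1r (le_trans (enorm_lip _ _))//.
  by rewrite opprB addrA subrK.
rewrite /landau; apply: econtD; first exact: econt_cst.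
under eq_fun do rewrite -mulNr -mulN1r.
apply: econtM; last exact: econt_cst.
by apply: econtM; [exact: econt_cst | exact: econtX].
Qed.

Lemma econt_landau (M : R) : econt (landau M).
Proof. by have := econt_landau_sub M 0; under eq_fun do rewrite subr0. Qed.

(** Each term separates into powers of a coordinate of [x] and a function of [y], as the induction
    on the exponent requires. *)
Lemma landau_sub (M : R) x y : landau M (y - x) = landau M y
  + \sum_i (x ord0 i * (2 / M ^+ 2 * y ord0 i) + x ord0 i * (x ord0 i * (- (M ^+ 2)^-1))).
Proof.
rewrite /landau !enorm_sqr -addrA; congr (1 + _); rewrite -mulNr -mulNr /dot -!sumrN !mulr_suml.
by rewrite -big_split; apply: eq_bigr => i _; rewrite !mxE /=; ring.
Qed.

(** One factor of the kernel is expanded by [landau_sub]; its [y]-dependent coefficients are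
    absorbed into the weight, which is why [w] is arbitrary. Each factor costs at most two degrees
    in [x]. *)
Lemma smoothing_poly (M : R) k w : cc w ->
  is_poly_le (fun x => ((I (fun y => w y * landau M (y - x) ^+ k))%:C)%C) k.*2.
Proof.
elim: k w => [|k IH] w cw.
  have -> : (fun x => ((I (fun y => w y * landau M (y - x) ^+ 0))%:C)%C) = fun=> ((I w)%:C)%C.
    apply/funext => x; congr (_%:C)%C; congr I.
    by apply/funext => y; rewrite expr0 mulr1.
  exact: poly_le_cst.
pose w0 y := w y * landau M y.
pose w1 i y := w y * (2 / M ^+ 2 * y ord0 i).
pose w2 y := w y * (- (M ^+ 2)^-1).
have cw0 : cc w0 by apply: ccM => //; exact: econt_landau.
have cw1 i : cc (w1 i).
  by apply: ccM => //; apply: econtM; [exact: econt_cst | exact: econt_coord].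
have cw2 : cc w2 by apply: ccM => //; exact: econt_cst.
have cl x : econt (fun y => landau M (y - x) ^+ k) by apply: econtX; exact: econt_landau_sub.
pose J w x := I (fun y => w y * landau M (y - x) ^+ k).
have -> : (fun x => ((I (fun y => w y * landau M (y - x) ^+ k.+1))%:C)%C) =
  fun x => ((J w0 x)%:C)%C + \sum_i (((x ord0 i)%:C)%C * ((J (w1 i) x)%:C)%C +
     ((x ord0 i)%:C)%C * (((x ord0 i)%:C)%C * ((J w2 x)%:C)%C)).
  apply/funext => x.
  have -> : (fun y => w y * landau M (y - x) ^+ k.+1) = fun y =>
      w0 y * landau M (y - x) ^+ k + \sum_i (x ord0 i * (w1 i y * landau M (y - x) ^+ k) +
        x ord0 i * (x ord0 i * (w2 y * landau M (y - x) ^+ k))).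
    apply/funext => y; rewrite exprS; set P := _ ^+ k.
    rewrite landau_sub mulrDl mulrDr; congr (_ + _); first by rewrite /w0 mulrA.
    rewrite mulr_suml mulr_sumr; apply: eq_bigr => i _.
    by rewrite /w1 /w2; ring.
  have c1 i : cc (fun y => x ord0 i * (w1 i y * landau M (y - x) ^+ k)).
    by apply/ccZ/ccM.
  have c2 i : cc (fun y => x ord0 i * (x ord0 i * (w2 y * landau M (y - x) ^+ k))).
    by apply/ccZ/ccZ/ccM.
  have c12 i := ccD (c1 i) (c2 i).
  rewrite (haarD HI); [|exact: ccM|exact: cc_sum].
  rewrite haar_sum// rmorphD rmorph_sum; congr (_ + _); apply: eq_bigr => i _.
  rewrite (haarD HI)// (haarZ HI); last exact: ccM.
  rewrite (haarZ HI); last by apply/ccZ/ccM.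
  rewrite (haarZ HI); last exact: ccM.
  by rewrite rmorphD !rmorphM.
have two : (k.*2 <= k.+1.*2)%N by rewrite leq_double.
apply: poly_le_add; first exact: poly_le_widen two (IH _ cw0).
apply: poly_le_sum => i _; apply: poly_le_add.
  apply: (@poly_le_widen _ _ _ k.*2.+1); first by rewrite doubleS.
  by apply: poly_le_mulX; exact: IH.
by rewrite doubleS; do 2 apply: poly_le_mulX; exact: IH.
Qed.

(** One radius [A] serves all bodies, so that the supports of the orbits of neighbouring bodies are
    controlled together. *)
Definition locally_supported T := exists A : R, forall K (M : R), convex_body K ->
  (forall x, K x -> enorm x <= M) ->
  forall y, A + M < enorm y -> T (translate K y) = 0.

Variables (T : set vec -> R).
Hypotheses (cT : hcont T) (sT : locally_supported T).

Lemma cc_orbit K : convex_body K -> cc (fun y => T (translate K y)).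
Proof.
move=> bK; split; first exact: econt_orbit.
by have [A hA] := sT; have [M _ hM] := body_bounded bK; exists (A + M); exact: hA.
Qed.

Definition smoothing (M : R) k K : R :=
  I (fun y => T (translate K y) * landau M y ^+ k).

Lemma cc_smoothing (M : R) k K : convex_body K ->
  cc (fun y => T (translate K y) * landau M y ^+ k).
Proof. by move=> bK; apply: ccM; [exact: cc_orbit | apply: econtX; exact: econt_landau]. Qed.

Lemma smoothing_valuation (M : R) k : rvaluation T -> rvaluation (smoothing M k).
Proof.
move=> vT K1 K2 b1 b2 b12; have bI := body_inter b1 b2 b12.
rewrite /smoothing -!(haarD HI); try exact: cc_smoothing.
congr I; apply/funext => y; rewrite -!mulrDl; congr (_ * _).
rewrite translateU translateI; apply: vT; try exact: body_translate.
by rewrite -translateU; exact: body_translate.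
Qed.

Lemma smoothing_invariant so (M : R) k : rinvariant so T -> rinvariant so (smoothing M k).
Proof.
move=> iT U GU K bK; have hU := GU.1; have hU' := mulmx1C hU.
have hUT : U^T *m U^T^T = 1%:M by rewrite trmxK.
rewrite /smoothing.
rewrite -[RHS](haar_isom HI (0 : vec) (cc_smoothing M k bK) hU).
congr I; apply/funext => y.
rewrite translate_image// iT ?addr0//; last exact: body_translate.
by congr (_ * _ ^+ _); rewrite /landau enorm_orth.
Qed.

Lemma smoothing_polynomial (M : R) k K : convex_body K ->
  is_poly_le (fun x => ((smoothing M k (translate K x))%:C)%C) k.*2.
Proof.
move=> bK; have := smoothing_poly M k (cc_orbit bK); congr is_poly_le.
apply/funext => x; congr (_%:C)%C.
have h1 : (1%:M : 'M[R]_d) *m 1%:M^T = 1%:M by rewrite trmx1 mulmx1.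
(* The substitution of [y - x] for [y] moves [x] from the body to the kernel. *)
rewrite -[RHS](haar_isom HI (- x) (cc_smoothing M k (body_translate x bK)) h1).
congr I; apply/funext => y; rewrite mulmx1 translateD.
by congr (T (translate K _) * _); rewrite addrC subrK.
Qed.

(** Orbits of nearby bodies are uniformly close and vanish outside a common ball, on which the
    kernel is bounded by [Q]; a tent that is at least 1 on this ball dominates the difference. *)
Lemma smoothing_hcont (M : R) k : hcont (smoothing M k).
Proof.
move=> K bK V /nbhs_ballP[e e0 eV].
have [A hA] := sT; have [N N0 hN] := body_bounded bK.
(* A body within Hausdorff distance 1 of [K] is contained in the ball of radius [N + 1]. *)
pose B := Num.max 0 (A + (N + 1)).
have B0 : 0 <= B by rewrite le_max lexx.
have BA : A + (N + 1) <= B by rewrite le_max lexx orbT.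
pose Q := (1 + B ^+ 2 / M ^+ 2) ^+ k.
have BM0 : 0 <= B ^+ 2 / M ^+ 2 by rewrite divr_ge0 ?sqr_ge0.
have Q0 : 0 <= Q by rewrite exprn_ge0// addr_ge0.
pose J := I (@bump R d (B + 1)).
have J0 : 0 <= J by apply: haar_ge0 (cc_bump _ _) _ => x; exact: bump_ge0.
have QJ0 : 0 <= Q * J by rewrite mulr_ge0.
pose eta := e / (Q * J + 1).
have eta0 : 0 < eta by rewrite divr_gt0// ltr_wpDl.
have [del del0 hd] := hcont_unif B cT bK eta0.
exists (Num.min 1 del); first by rewrite lt_min ltr01.
move=> L bL KL; apply: eV; rewrite /ball /=.
have KL1 : hnear 1 K L by apply: hnearW KL; rewrite ge_min lexx.
have KLd : hnear del K L by apply: hnearW KL; rewrite ge_min lexx orbT.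
have hL := hnear_bound KL1 hN.
apply: (@le_lt_trans _ _ (eta * Q * J)); last first.
  have : eta * (Q * J + 1) = e by rewrite mulfVK// gt_eqF// ltr_wpDl.
  by rewrite -mulrA; lra.
rewrite /J -(haarZ HI); last exact: cc_bump.
apply: haar_dist; try exact: cc_smoothing; first exact/ccZ/cc_bump.
move=> y; rewrite -mulrBl normrM.
have [yB|yB] := leP (enorm y) B; last first.
  rewrite (hA K N)//; last lra.
  have yL : A + (N + 1) < enorm y by lra.
  rewrite (hA L (N + 1))// subrr normr0 mul0r.
  by rewrite mulr_ge0 ?bump_ge0// mulr_ge0// ltW.
have b1 : 1 <= bump (B + 1) y by have := bump_ge (B + 1) y; lra.
have hQ : `|landau M y ^+ k| <= Q.
  rewrite normrX lerXn2r ?nnegrE ?addr_ge0//.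
  rewrite (le_trans (ler_normB _ _))// normr1 lerD2l ger0_norm ?divr_ge0 ?sqr_ge0//.
  by rewrite ler_wpM2r ?invr_ge0 ?sqr_ge0// lerXn2r ?nnegrE ?enorm_ge0.
apply: (@le_trans _ _ (eta * Q)); first by apply: ler_pM => //; apply: ltW; exact: hd.
by rewrite ler_peMr// mulr_ge0// ltW.
Qed.

End Smoothing.

(** * Uniform estimates over a compact family of bodies *)

Section CompactFamilies.
Variables (R : realType) (d : nat).
Local Notation vec := 'rV[R]_d.
Implicit Types (x y z : vec) (K L : set vec) (C : set (set vec)) (T : set vec -> R).

Lemma finite_lower (J : Type) (D : set J) (f : J -> R) : finite_set D ->
  (forall j, 0 < f j) -> exists2 m : R, 0 < m & forall j, D j -> m <= f j.
Proof.
move=> /(finite_image f)/finite_seqP[s sE] f0.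
have [|m m0 hm] := @seq_lower R R s (fun r => if 0 < r then r else 1).
  by move=> r; case: ifP.
exists m => // j Dj; have : f j \in s by have : (f @` D) (f j) by [exists j]; rewrite sE.
by move=> /hm; rewrite f0.
Qed.

Lemma finite_upper (J : Type) (D : set J) (f : J -> R) : finite_set D ->
  exists2 m : R, 0 <= m & forall j, D j -> f j <= m.
Proof.
move=> /(finite_image f)/finite_seqP[s sE].
have [m m0 hm] := @seq_upper R R s id.
exists m => // j Dj; have : f j \in s by have : (f @` D) (f j) by [exists j]; rewrite sE.
by move=> /hm.
Qed.

Lemma choose_on C (P : set vec -> R -> Prop) :
  (forall K, C K -> exists b, P K b) -> exists f, forall K, C K -> P K (f K).
Proof.
move=> h; have [|f hf] := @choice (set vec) R (fun K b => C K -> P K b).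
  by move=> K; have [/h[b Pb]|nC] := pselect (C K); [exists b | exists 0].
by exists f.
Qed.

Lemma choose_pos_on C (P : set vec -> R -> Prop) :
  (forall K, C K -> exists2 b, 0 < b & P K b) ->
  exists2 f, (forall K, 0 < f K) & forall K, C K -> P K (f K).
Proof.
move=> h; have [|f hf] := @choice (set vec) R (fun K b => 0 < b /\ (C K -> P K b)).
  by move=> K; have [/h[b b0 Pb]|nC] := pselect (C K); [exists b | exists 1].
by exists f => K; [exact: (hf K).1 | exact: (hf K).2].
Qed.

Lemma hd_cover C (del : set vec -> R) : hd_compact C -> (forall K, 0 < del K) ->
  exists2 D, finite_set D &
    forall L, C L -> exists2 K, D K & C K /\ hnear (del K) K L.
Proof.
move=> [bC cC] del0.
(* The slack [a < del K] makes the set open for the Hausdorff distance; recording [C K] keeps the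
   centres of the subcover in [C]. *)
pose U K := [set L | C K /\ exists2 a : R, a < del K & hnear a K L].
have [||D fD hD] := cC (set vec) U.
- move=> K L bL [CK [a adel KL]].
  exists ((del K - a) / 2); first by rewrite divr_gt0// subr_gt0.
  move=> N bN /(hausdorff_hnear bL bN) LN; split=> //.
  by exists (a + (del K - a) / 2); [lra | exact: hnear_trans LN].
- move=> K CK; exists K; split=> //; have := del0 K.
  by exists (del K / 2); [lra | apply: hnear_refl; lra].
exists D => // L /hD[K DK [CK [a adel KL]]]; exists K => //; split=> //.
exact: hnearW (ltW adel) KL.
Qed.

Lemma hd_compact_bounded C : hd_compact C ->
  exists2 r : R, 0 <= r & forall K, C K -> forall x, K x -> enorm x <= r.
Proof.
move=> cC; have [|bnd bndP] := @choose_on C (fun K b => forall x, K x -> enorm x <= b).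
  move=> K CK.
  by have [M _ hM] := body_bounded (cC.1 K CK); exists M.
have [D fD hD] := hd_cover cC (fun=> ltr01 : 0 < 1 :> R).
have [m m0 hm] := finite_upper bnd fD.
exists (m + 1); first by rewrite addr_ge0.
move=> L /hD[K DK [CK KL]] x Lx.
apply: (hnear_bound KL) Lx => z Kz; exact: le_trans (bndP K CK z Kz) (hm K DK).
Qed.

(** Continuity in [y] bounds a single orbit on the ball, [hcont_unif] extends the bound to nearby
    bodies, and finitely many neighbourhoods cover [C]. *)
Lemma orbits_bounded C T (A : R) : hd_compact C -> hcont T ->
  exists2 S : R, 0 <= S & forall K y, C K -> enorm y <= A -> `|T (translate K y)| <= S.
Proof.
move=> cC cT.
have [|bnd bndP] := @choose_on C (fun K b => forall y, enorm y <= A -> `|T (translate K y)| <= b).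
  move=> K CK; have bK := cC.1 K CK.
  (* The cutoff is 1 on the ball of radius [A] and makes [cc_bounded] applicable to an orbit of
     unbounded support. *)
  have cc1 : cc (fun y => T (translate K y) * (Num.min 1 (bump (`|A| + 1) y))).
    have E : (fun y => T (translate K y) * Num.min 1 (bump (`|A| + 1) y)) =
       fun y => (Num.min 1 (bump (`|A| + 1) y)) * T (translate K y).
      by apply/funext => y; rewrite mulrC.
    rewrite E; apply: ccM; last exact: econt_orbit.
    exact: cc_cutoff.
  have [S S0 hS] := cc_bounded cc1; exists S => y yA; have := hS y.
  rewrite cutoff1 ?mulr1//; have := ler_norm A; lra.
have [|del del0 delP] := @choose_pos_on C (fun K b => forall L, convex_body L ->
    hnear b K L -> forall y, enorm y <= A -> `|T (translate K y) - T (translate L y)| < 1).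
  move=> K CK.
  by have [del del0 h] := hcont_unif A cT (cC.1 K CK) ltr01; exists del.
have [D fD hD] := hd_cover cC del0.
have [m m0 hm] := finite_upper bnd fD.
exists (m + 1); first by rewrite addr_ge0.
move=> L y CL yA; have [K DK [CK KL]] := hD L CL.
have h1 := delP K CK L (cC.1 L CL) KL y yA.
have h2 := le_trans (bndP K CK y yA) (hm K DK).
have := ler_normB (T (translate K y)) (T (translate K y) - T (translate L y)).
by rewrite opprB addrC subrK; lra.
Qed.

(** Three errors of [e / 3]: from the orbit of the given body to that of a nearby centre at [y],
    along the orbit of the centre, and back at 0. *)
Lemma orbits_equicontinuous C T (e : R) : hd_compact C -> hcont T -> 0 < e ->
  exists2 del : R, 0 < del &
    forall K y, C K -> enorm y < del -> `|T (translate K y) - T K| <= e.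
Proof.
move=> cC cT e0; have e30 : 0 < e / 3 by rewrite divr_gt0.
have [|rad rad0 radP] := @choose_pos_on C (fun K b =>
    forall y, enorm y < b -> `|T K - T (translate K y)| < e / 3).
  move=> K CK.
  have [r r0 h] := econt_orbit cT (cC.1 K CK) 0 e30; exists r => // y yr.
  by have := h y; rewrite translate0 sub0r enormN; apply.
have [|del del0 delP] := @choose_pos_on C (fun K b => forall L, convex_body L ->
    hnear b K L -> forall y, enorm y <= 1 -> `|T (translate K y) - T (translate L y)| < e / 3).
  move=> K CK.
  by have [del del0 h] := hcont_unif 1 cT (cC.1 K CK) e30; exists del.
have [D fD hD] := hd_cover cC del0.
have [m m0 hm] := finite_lower fD rad0.
exists (Num.min 1 m); first by rewrite lt_min ltr01.
move=> L y CL; rewrite lt_min => /andP[y1 ym]; have [K DK [CK KL]] := hD L CL.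
have yr : enorm y < rad K by exact: lt_le_trans ym (hm K DK).
have := delP K CK L (cC.1 L CL) KL y (ltW y1).
have := delP K CK L (cC.1 L CL) KL 0; rewrite enorm0 !translate0 => /(_ ler01).
have := radP K CK y yr; rewrite !ltr_norml ler_norml.
by move=> /andP[? ?] /andP[? ?] /andP[? ?]; apply/andP; split; lra.
Qed.

End CompactFamilies.

Lemma expr_small (R : realType) (rho eps : R) : 0 <= rho < 1 -> 0 < eps ->
  exists k0, forall k, (k0 <= k)%N -> rho ^+ k <= eps.
Proof.
move=> /andP[r0 r1] eps0.
have /cvgrPdist_le/(_ eps eps0) : (rho ^+ k) @[k --> \oo] --> 0.
  by apply: cvg_expr; rewrite ger0_norm.
move=> [k0 _ h]; exists k0 => k /h /=.
by rewrite sub0r normrN ger0_norm// exprn_ge0.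
Qed.

(** * Concentration of the Landau kernel at the origin *)

Section Concentration.
Variables (R : realType) (d : nat) (I : ('rV[R]_d -> R) -> R).
Hypothesis HI : haar_functional I.
Local Notation vec := 'rV[R]_d.
Implicit Types (K : set vec) (C : set (set vec)) (T : set vec -> R) (k : nat).

(** Close to the origin the orbit is within [e / 2] of [T K]. Further away the kernel is at most
    [a^k], whereas its mass is at least a multiple of [b^k] with [a < b], so the tail is negligible
    after normalisation. The factor [c] is the same for all bodies in [C]. *)
Lemma concentration C T (A S e : R) : hcont T -> locally_supported T ->
  (forall K, C K -> convex_body K) -> 0 <= A -> 0 < e ->
  (forall K y, C K -> A < enorm y -> T (translate K y) = 0) ->
  (forall K y, C K -> enorm y <= A -> `|T (translate K y)| <= S) ->
  (exists2 del : R, 0 < del &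
    forall K y, C K -> enorm y < del -> `|T (translate K y) - T K| <= e / 2) ->
  exists k0, forall k, (k0 <= k)%N -> exists c : R,
    forall K, C K -> `|T K - c * smoothing I T (A + 1) k K| <= e.
Proof.
move=> cT sT bC A0 e0 TA TS [del0 del00 hdel0].
pose del := Num.min 1 del0.
have del_gt0 : 0 < del by rewrite lt_min ltr01.
have del1 : del <= 1 by rewrite ge_min lexx.
have hdel K y : C K -> enorm y < del -> `|T (translate K y) - T K| <= e / 2.
  by move=> CK; rewrite lt_min => /andP[_]; exact: hdel0.
set M := A + 1; have M0 : 0 < M by rewrite /M; lra.
have M20 : 0 < M ^+ 2 by rewrite exprn_gt0.
pose S1 := Num.max 0 S; have S10 : 0 <= S1 by rewrite le_max lexx.
have hS K y : C K -> `|T (translate K y)| <= S1.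
  move=> CK; have [yA|yA] := leP (enorm y) A; last by rewrite TA// normr0.
  by rewrite le_max TS ?orbT.
(* The cutoff gives the kernel a finite mass: it is 1 where orbits may be nonzero and 0 where the
   kernel may be negative. *)
pose chi (y : vec) : R := Num.min 1 (bump M y).
have chi0 y : 0 <= chi y by rewrite le_min ler01 bump_ge0.
have chi1 y : chi y <= 1 by rewrite ge_min lexx.
have chiA y : enorm y <= A -> chi y = 1 by move=> yA; apply: cutoff1; rewrite /M; lra.
have chiM y : M <= enorm y -> chi y = 0.
  by move=> yM; rewrite /chi bump_eq0// (min_idPr _) ?ler01.
have cchi : cc chi by exact: cc_cutoff.
(* Values of the kernel base on the spheres of radius [del] and [del / 2]. *)
pose a := 1 - del ^+ 2 / M ^+ 2; pose b := 1 - (del / 2) ^+ 2 / M ^+ 2.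
have dM : del ^+ 2 / M ^+ 2 <= 1.
  by rewrite ler_pdivrMr// mul1r lerXn2r ?nnegrE ?(ltW del_gt0) ?(ltW M0)// /M; lra.
have d20 : 0 < del ^+ 2 / M ^+ 2 by rewrite divr_gt0// exprn_gt0.
have a0 : 0 <= a by rewrite subr_ge0.
have bE : b = 1 - del ^+ 2 / M ^+ 2 / 4.
  by rewrite /b; congr (1 - _); field; rewrite gt_eqF.
have b0 : 0 < b by rewrite bE; lra.
have ab : a < b by rewrite bE /a; lra.
have q0 y : enorm y <= M -> 0 <= landau M y.
  move=> yM; rewrite /landau subr_ge0 ler_pdivrMr// mul1r.
  by rewrite lerXn2r ?nnegrE ?enorm_ge0 ?(ltW M0).
have qa y : del <= enorm y -> landau M y <= a.
  move=> dy; rewrite /landau /a lerD2l lerN2 ler_wpM2r ?invr_ge0 ?(ltW M20)//.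
  by rewrite lerXn2r ?nnegrE ?enorm_ge0 ?(ltW del_gt0).
have qb y : enorm y <= del / 2 -> b <= landau M y.
  move=> dy; rewrite /landau /b lerD2l lerN2 ler_wpM2r ?invr_ge0 ?(ltW M20)//.
  by rewrite lerXn2r ?nnegrE ?enorm_ge0//; lra.
pose J := I (@bump R d (del / 2)).
have J0 : 0 < J by apply: haar_bump => //; lra.
have Ichi0 : 0 <= I chi by exact: haar_ge0.
(* With [(a / b)^k <= eta], the tail [2 S1 a^k I chi] is at most [e / 2] times [b^k J], a lower
   bound for the mass [m]. *)
pose eta := e / 2 * J / (2 * S1 * I chi + 1).
have Q0 : 0 <= 2 * S1 * I chi by rewrite !mulr_ge0.
have eta0 : 0 < eta by rewrite !(divr_gt0, mulr_gt0)//; lra.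
have etaE : eta * (2 * S1 * I chi) <= e / 2 * J.
  have : eta * (2 * S1 * I chi + 1) = e / 2 * J.
    by rewrite /eta mulfVK// gt_eqF//; lra.
  by rewrite mulrDr mulr1; lra.
have [||k0 hk0] := @expr_small R (a / b) eta.
- by rewrite divr_ge0 ?(ltW b0)//= ltr_pdivrMr// mul1r.
- by [].
exists k0 => k /hk0 abk.
pose m := I (fun y => chi y * landau M y ^+ k).
have cq : econt (fun y : vec => landau M y ^+ k) by apply: econtX; exact: econt_landau.
have ccq : cc (fun y => chi y * landau M y ^+ k) by exact: ccM.
have bk0 : 0 < b ^+ k by rewrite exprn_gt0.
have mJ : b ^+ k * J <= m.
  rewrite /J -(haarZ HI); last exact: cc_bump.
  apply: haar_le => //; first exact/ccZ/cc_bump.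
  move=> y; have [yd|yd] := leP (del / 2) (enorm y).
    rewrite bump_eq0// mulr0; have [yM|yM] := leP (enorm y) M.
      by rewrite mulr_ge0// exprn_ge0// q0.
    by rewrite chiM ?mul0r// ltW.
  rewrite mulrC; apply: ler_pM; rewrite ?bump_ge0 ?(ltW bk0)//.
    have h : bump (del / 2) y = del / 2 - enorm y.
      by rewrite /bump (max_idPr _)// subr_ge0 ltW.
    rewrite h le_min; have := enorm_ge0 y; have := bump_ge M y; rewrite /M => ? ?.
    by apply/andP; split; lra.
  by rewrite lerXn2r ?nnegrE ?(ltW b0)// ?qb ?(le_trans (ltW b0))// ?qb// ltW.
have m0 : 0 < m by apply: lt_le_trans mJ; rewrite mulr_gt0.
exists m^-1 => K CK; have bK := bC K CK.
have key : `|T K * m - smoothing I T M k K| <= e / 2 * m + 2 * S1 * a ^+ k * I chi.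
  rewrite /m -!(haarZ HI)// -(haarD HI); [|exact: ccZ|exact: ccZ].
  apply: haar_dist => //.
  - exact: ccZ.
  - exact: cc_smoothing.
  - by apply: ccD; exact: ccZ.
  move=> y.
  (* Inserting [chi] changes nothing, since the orbit vanishes wherever [chi] differs from 1. *)
  have -> : T (translate K y) * landau M y ^+ k =
      T (translate K y) * (chi y * landau M y ^+ k).
    have [yA|yA] := leP (enorm y) A; first by rewrite chiA// mul1r.
    by rewrite TA// !mul0r.
  rewrite -mulrBl.
  have [yM|yM] := leP (enorm y) M; last first.
    by rewrite (chiM y) ?(ltW yM)// !(mul0r, mulr0) normr0 addr0.
  have qk0 : 0 <= landau M y ^+ k by rewrite exprn_ge0// q0.
  have cq0 : 0 <= chi y * landau M y ^+ k by rewrite mulr_ge0.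
  have ak0 : 0 <= a ^+ k by rewrite exprn_ge0.
  rewrite normrM (ger0_norm cq0).
  have [yd|yd] := ltP (enorm y) del.
    rewrite -[leLHS]addr0 lerD// ?mulr_ge0//.
    by rewrite ler_wpM2r// distrC hdel.
  rewrite -[leLHS]add0r lerD//; first by rewrite mulr_ge0//; lra.
  have hT : `|T K - T (translate K y)| <= 2 * S1.
    have := hS K y CK; have := hS K 0 CK; rewrite translate0.
    by have := ler_normB (T K) (T (translate K y)); lra.
  rewrite -[leRHS]mulrA (mulrC _ (chi y)); apply: ler_pM => //; apply: ler_wpM2l => //.
  by rewrite lerXn2r ?nnegrE ?q0 ?qa.
have -> : T K - m^-1 * smoothing I T M k K = (T K * m - smoothing I T M k K) / m.
  by field; rewrite gt_eqF.
rewrite normrM normfV (gtr0_norm m0) ler_pdivrMr//.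
apply: (le_trans key).
have ak : a ^+ k <= eta * b ^+ k.
  by move: abk; rewrite expr_div_n ler_pdivrMr// exprn_gt0.
have s1 : a ^+ k * (2 * S1 * I chi) <= eta * b ^+ k * (2 * S1 * I chi).
  by rewrite ler_wpM2r.
have s2 : eta * (2 * S1 * I chi) * b ^+ k <= e / 2 * J * b ^+ k.
  by rewrite ler_wpM2r// ltW.
have s3 : e / 2 * (b ^+ k * J) <= e / 2 * m by rewrite ler_wpM2l//; lra.
by lra.
Qed.

End Concentration.

(** * Approximation of real valuations *)

Section RealApproximation.
Variables (R : realType) (d : nat).
Local Notation vec := 'rV[R]_d.
Implicit Types (K : set vec) (C : set (set vec)) (F : set vec -> R) (k : nat).

(** Valid for every large [k], so that the real and imaginary parts of a complex valuation can later
    use the same exponent. *)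
Lemma real_approximation so F C (e : R) : rvaluation F -> hcont F -> rinvariant so F ->
  hd_compact C -> 0 < e ->
  exists k0, forall k, (k0 <= k)%N -> exists psi : set vec -> R,
    [/\ rvaluation psi, hcont psi, rinvariant so psi,
        forall K, convex_body K ->
          is_poly_le (fun x => ((psi (translate K x))%:C)%C) k.*2 &
        forall K, C K -> `|F K - psi K| <= e].
Proof.
move=> vF cF iF cC e0; have [I HI] := haar_exists R d.
have [r r0 hr] := hd_compact_bounded cC.
pose T := trunc_val F r.
have cT : hcont T by exact: trunc_val_hcont.
have sT : locally_supported T.
  by exists (r + 1) => K M bK hM y; exact: trunc_val_eq0.
(* A body in the ball of radius [r] misses the ball of radius [r + 1] once translated by more than
   this. *)
pose A := r + 1 + r; have A0 : 0 <= A by rewrite /A; lra.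
have TA K y : C K -> A < enorm y -> T (translate K y) = 0.
  by move=> CK; apply: trunc_val_eq0; [exact: cC.1 | exact: hr].
have [S S0 hS] := orbits_bounded A cC cT.
have e20 : 0 < e / 2 by rewrite divr_gt0.
have [k0 hk0] := concentration HI cT sT cC.1 A0 e0 TA hS (orbits_equicontinuous cC cT e20).
exists k0 => k /hk0[c hc]; exists (fun K => c * smoothing I T (A + 1) k K).
have vS := smoothing_valuation HI cT sT (A + 1) k (trunc_val_valuation r vF).
have iS := smoothing_invariant HI cT sT (A + 1) k (trunc_val_invariant r iF).
have cS : hcont (smoothing I T (A + 1) k) by exact: smoothing_hcont.
split.
- by move=> K1 K2 b1 b2 b12; rewrite -!mulrDr vS.
- by move=> K bK; apply: cvgM; [exact: cvg_cst | exact: cS].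
- by move=> U GU K bK; rewrite iS.
- move=> K bK; have := poly_le_scale (c%:C)%C (smoothing_polynomial HI cT sT (A + 1) k bK).
  by congr is_poly_le; apply/funext => x; rewrite rmorphM.
- by move=> K CK; have := hc K CK; rewrite /T trunc_val_id//; [exact: cC.1 | exact: hr].
Qed.

End RealApproximation.

(** * Passage to complex values through real and imaginary parts *)

Section ComplexParts.
Variables (R : realType).
Implicit Types (z : R[i]).

Lemma complex_norm_le z : `|z| <= ((`|complex.Re z| + `|complex.Im z|)%:C)%C.
Proof.
case: z => a b; rewrite normc_def lecR /=.
rewrite -(ler_pXn2r (n := 2)) ?nnegrE ?sqrtr_ge0 ?addr_ge0//.
rewrite sqr_sqrtr ?addr_ge0 ?sqr_ge0// sqrrD !real_normK ?num_real//.
have : 0 <= `|a| * `|b| by rewrite mulr_ge0.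
by rewrite mulr2n; lra.
Qed.

Lemma complex_Re_le z : (`|complex.Re z|%:C)%C <= `|z|.
Proof. exact: normc_ge_Re. Qed.

Lemma complex_Im_le z : (`|complex.Im z|%:C)%C <= `|z|.
Proof.
case: z => a b; rewrite normc_def lecR /= -sqrtr_sqr ler_wsqrtr// lerDr sqr_ge0//.
Qed.

Lemma complex_ReD z z' : complex.Re (z + z') = complex.Re z + complex.Re z'.
Proof. by case: z; case: z'. Qed.

Lemma complex_ImD z z' : complex.Im (z + z') = complex.Im z + complex.Im z'.
Proof. by case: z; case: z'. Qed.

Lemma complex_ReB z z' : complex.Re (z - z') = complex.Re z - complex.Re z'.
Proof. by case: z; case: z'. Qed.

Lemma complex_ImB z z' : complex.Im (z - z') = complex.Im z - complex.Im z'.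
Proof. by case: z; case: z'. Qed.

End ComplexParts.

Theorem theoremA (R : realType) (d : nat) (so : bool)
  (phi : set 'rV[R]_d -> R[i]) :
  (1 <= d)%N ->
  is_valuation phi -> val_continuous phi -> G_invariant so phi ->
  forall C : set (set 'rV[R]_d), hd_compact C ->
  forall eps : R, 0 < eps ->
  exists (l : nat) (psi : set 'rV[R]_d -> R[i]),
    [/\ is_valuation psi, val_continuous psi, G_invariant so psi,
        polynomial_valuation_le psi l &
        exists2 s : R, s < eps &
          forall K, C K -> `|phi K - psi K| <= (s%:C)%C].
Proof.
move=> _ vphi cphi iphi C cC eps eps0.
pose F1 K := complex.Re (phi K); pose F2 K := complex.Im (phi K).
have v1 : rvaluation F1.
  by move=> K1 K2 b1 b2 b12; rewrite /F1 -!complex_ReD vphi.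
have v2 : rvaluation F2.
  by move=> K1 K2 b1 b2 b12; rewrite /F2 -!complex_ImD vphi.
have i1 : rinvariant so F1 by move=> U GU K bK; rewrite /F1 iphi.
have i2 : rinvariant so F2 by move=> U GU K bK; rewrite /F2 iphi.
have c1 : hcont F1.
  apply/hcontP => K bK e e0; have [del del0 h] := cphi K bK e e0.
  exists del => // L bL /(h L bL); rewrite /F1 -complex_ReB -ltcR.
  by apply: le_lt_trans; exact: complex_Re_le.
have c2 : hcont F2.
  apply/hcontP => K bK e e0; have [del del0 h] := cphi K bK e e0.
  exists del => // L bL /(h L bL); rewrite /F2 -complex_ImB -ltcR.
  by apply: le_lt_trans; exact: complex_Im_le.
(* Both parts together cost [eps / 2], which leaves a strict gap below [eps] for the supremum. *)
have e40 : 0 < eps / 4 by rewrite divr_gt0.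
have [k1 h1] := real_approximation v1 c1 i1 cC e40.
have [k2 h2] := real_approximation v2 c2 i2 cC e40.
(* A common exponent gives both parts the same degree bound. *)
have [psi1 [pv1 pc1 pi1 pp1 pa1]] := h1 (maxn k1 k2) (leq_maxl _ _).
have [psi2 [pv2 pc2 pi2 pp2 pa2]] := h2 (maxn k1 k2) (leq_maxr _ _).
exists (maxn k1 k2).*2, (fun K => (psi1 K +i* psi2 K)%C); split.
- move=> K1 K2 b1 b2 b12.
  by rewrite /GRing.add /= pv1// pv2.
- move=> K bK e e0; have e20 : 0 < e / 2 by rewrite divr_gt0.
  move: pc1 => /hcontP/(_ K bK _ e20)[d1 d10 hd1].
  move: pc2 => /hcontP/(_ K bK _ e20)[d2 d20 hd2].
  exists (Num.min d1 d2); first by rewrite lt_min d10.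
  move=> L bL; rewrite lt_min => /andP[/(hd1 L bL) {}hd1 /(hd2 L bL) {}hd2].
  apply: le_lt_trans (complex_norm_le _) _.
  by rewrite complex_ReB complex_ImB ltcR /=; lra.
- by move=> U GU K bK; rewrite pi1// pi2.
- move=> K bK; have h := poly_le_add (pp1 K bK) (poly_le_scale 'i%C (pp2 K bK)).
  move: h; congr is_poly_le; apply/funext => x.
  by rewrite [RHS]complexE.
exists (eps / 2); first lra.
move=> K CK; apply: le_trans (complex_norm_le _) _.
rewrite complex_ReB complex_ImB lecR /=.
by have := pa1 K CK; have := pa2 K CK; rewrite /F1 /F2; lra.
Qed.
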